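(* Let $\beta$ be a Pisot unit such that the unit group $\mathcal{O}_{\mathbb{Q}(\beta)}^*$ of the ring of integers of $\mathbb{Q}(\beta)$ has rank $1$, and let $(n_i)_{i=0}^\infty$ be an integer-valued linear recurrent sequence with characteristic polynomial the minimal polynomial of $\beta$ over $\mathbb{Q}$. Let $I$ be an arbitrary subset of $\mathbb{N}_0$. Then the set $\{n_i \mid i \in I\}\subseteq\mathbb{Z}$ is generalised polynomial.
   Context: $\mathbb{N}_0=\{0,1,2,\dots\}$. The class of generalised polynomial maps $\mathbb{Z}\to\mathbb{R}$ is the smallest class of functions $\mathbb{Z}\to\mathbb{R}$ that contains all real constants and the identity and is closed under pointwise addition, multiplication, and replacing $f$ by $\lfloor f\rfloor$. A set $E\subseteq\mathbb{Z}$ is generalised polynomial if its characteristic function $1_E\colon\mathbb{Z}\to\{0,1\}$ is a generalised polynomial map. A conjugate of an algebraic number is any complex root of its minimal polynomial over $\mathbb{Q}$. A Pisot unit is a real algebraic number $\beta>1$ that is a unit (both $\beta$ and $1/\beta$ are algebraic integers) and such that all conjugates $\alpha\neq\beta$ of $\beta$ satisfy $|\alpha|<1$. A sequence $(n_i)_{i=0}^\infty$ is linear recurrent with characteristic polynomial $X^m-\sum_{j=0}^{m-1}a_jX^j$ if $n_{i+m}=\sum_{j=0}^{m-1}a_jn_{i+j}$ for all $i\ge 0$. *)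

(* Defs.v *)
From HB Require Import structures.
From mathcomp Require Import all_boot all_order all_algebra.
From mathcomp Require Import complex.
From mathcomp Require Import boolp classical_sets reals numfun.

Set Implicit Arguments.
Unset Strict Implicit.
Unset Printing Implicit Defensive.

Import Order.TTheory GRing.Theory Num.Theory.

Local Open Scope classical_set_scope.
Local Open Scope ring_scope.

Inductive generalised_polynomial (R : realType) : (int -> R) -> Prop :=
| GPconst (c : R) : generalised_polynomial (fun=> c)
| GPid : generalised_polynomial (fun x => x%:~R)
| GPadd (f g : int -> R) : generalised_polynomial f ->
    generalised_polynomial g -> generalised_polynomial (fun x => f x + g x)
| GPmul (f g : int -> R) : generalised_polynomial f ->
    generalised_polynomial g -> generalised_polynomial (fun x => f x * g x)
| GPfloor (f : int -> R) : generalised_polynomial f ->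
    generalised_polynomial (fun x => (Num.floor (f x))%:~R).

Definition generalised_polynomial_set (R : realType) (E : set int) : Prop :=
  generalised_polynomial (\1_E : int -> R).

Definition algebraic_integer (F : numFieldType) (x : F) : Prop :=
  integralOver (intr : int -> F) x.

Definition minimal_polynomial (F : numFieldType) (x : F) (p : {poly rat}) :
    Prop :=
  [/\ p \is monic, root (map_poly ratr p) x &
      forall q : {poly rat}, q != 0 -> root (map_poly ratr q) x ->
        (size p <= size q)%N].

Definition conjugate_of (R : realType) (x : R) (z : R[i]) : Prop :=
  exists2 p : {poly rat}, minimal_polynomial x p & root (map_poly ratr p) z.

Definition Pisot_unit (R : realType) (beta : R) : Prop :=
  [/\ 1 < beta, algebraic_integer beta, algebraic_integer beta^-1 &
      forall z : R[i], conjugate_of beta z -> z != (beta%:C)%C -> `|z| < 1].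

Definition Q_adjoin (F : numFieldType) (x : F) : set F :=
  [set y | exists p q : {poly rat}, (map_poly ratr q).[x] != 0 /\
             y = (map_poly ratr p).[x] / (map_poly ratr q).[x]].

Definition ring_of_integers (F : numFieldType) (K : set F) : set F :=
  [set y | K y /\ algebraic_integer y].

Definition unit_group (F : fieldType) (A : set F) : set F :=
  [set y | [/\ y != 0, A y & A y^-1]].

Definition mul_independent (F : fieldType) (k : nat) (u : 'I_k -> F) : Prop :=
  forall e : 'I_k -> int, \prod_(i < k) u i ^ e i = 1 -> forall i, e i = 0.

(* Rank of an abelian group, here a multiplicative subgroup G of F: the       *)
(* largest size of a Z-independent family, i.e. the dimension over Q of the   *)
(* tensor product of G with Q.                                                *)
Definition mul_rank (F : fieldType) (G : set F) (r : nat) : Prop :=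
  (exists2 u : 'I_r -> F, forall i, G (u i) & mul_independent u) /\
  (forall (k : nat) (u : 'I_k -> F),
     (forall i, G (u i)) -> mul_independent u -> (k <= r)%N).

(* For monic c = X^m - \sum_(j < m) a_j X^j one has a_j = - c`_j.             *)
Definition linear_recurrent (F : nzRingType) (c : {poly F}) (u : nat -> F) :
    Prop :=
  c \is monic /\
  forall i : nat,
    u (i + (size c).-1)%N = \sum_(j < (size c).-1) (- c`_j) * u (i + j)%N.

(* Main.v *)
Require Import Defs.
From mathcomp Require Import all_boot all_order all_algebra perm.
From mathcomp Require Import complex separable.
From mathcomp Require Import boolp classical_sets reals numfun.
From mathcomp Require Import ring lra zify.

Set Implicit Arguments.
Unset Strict Implicit.
Unset Printing Implicit Defensive.
Import Order.TTheory GRing.Theory Num.Theory.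
Local Open Scope classical_set_scope.
Local Open Scope ring_scope.

(** The set is generalised polynomial because, up to finitely many points, it
is a subset of a generalised polynomial set [E] whose absolute values grow
geometrically, and every subset of such an [E] that is disjoint from its
opposite is generalised polynomial.

Subsets of sparse sets ([gpset_subset_lacunary]).  If [|x|] is lacunary on [E]
then [|x|^k] is as lacunary as one likes for [k] large, and nested intervals
give a real [th] for which the fractional parts of [th * |x|^k] take prescribed
approximate values on [E] ([lacunary_phases]).  So an arbitrary subset can be
coded in the digits of one real constant; taking [k] odd separates [x] from
[- x].

The sparse set.  Let [P] be the minimal polynomial of [beta], of degree [d]; it
has integer coefficients.  A vector [v] of [Z^d], read as [d] consecutive terms
of a sequence with characteristic polynomial [P], corresponds to an element
[xi v] of [Z[beta]] in such a way that shifting the sequence multiplies [xi v]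
by [beta] ([xi_companion]): [xi] is the left eigenvector, for the eigenvalue
[beta], of the companion matrix.  The determinant of the Krylov matrix with
columns [v], [M v], [M^2 v], and so on plays the role of the norm of [xi v]: it
is a polynomial in [v], it is a multiple of [xi v] in [Z[beta]]
([xi_divides_det]), it vanishes only with [xi v] ([det_krylov_neq0]), and the
shift preserves it up to sign since [beta] is a unit ([sqr_det_krylov]).  To an
integer [x] attach the vector [v x] of the roundings of
[x, beta x, beta^2 x], and so on, which is a generalised polynomial function of
[x].  As [beta] is Pisot, [n_(i+j) - beta^j n_i] tends to [0], so for large [i]
the vector attached to [n_i] is [(n_i, .., n_(i+d-1))] ([round_powers_n]).
Hence the equation [det^2 = N^2], with [N] the determinant for the given
sequence, defines a generalised polynomial set containing almost all the [n_i].

Sparsity ([value_gap]).  This is where the unit rank enters.  The elements of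
[Z[beta]] that divide [N] have absolute values lacking small ratios: after
division by a power of [beta] it is enough to show that finitely many of them
have absolute value at least 1 and less than [beta^2].  If two of these are congruent modulo [N],
their quotient is a unit [u]; in a group of rank 1 some relation
[u^a = beta^b] holds with [a > 0], and conjugating it bounds every conjugate of
[u] in terms of [|u|] ([unit_conj_bound]).  As there are finitely many classes
modulo [N], all conjugates are bounded, and integer coefficient vectors with
bounded conjugates are finite in number because the Vandermonde matrix of the
conjugates is invertible.  Since [xi (v x) = c x + O(1)], lacunarity of the
values [xi] passes to the integers [x]. *)

(** * Generalised polynomial maps and sets *)

Section GeneralisedPolynomials.
Variable R : realType.
Implicit Types (f g : int -> R) (E : set int).

Notation gp := (@generalised_polynomial R).
Notation gpset := (@generalised_polynomial_set R).

Lemma gp_ext f g : f =1 g -> gp f -> gp g.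
Proof. by move=> /funext ->. Qed.

Lemma gp_opp f : gp f -> gp (fun x => - f x).
Proof.
by move=> /(GPmul (GPconst (-1))); apply: gp_ext => x; rewrite mulN1r.
Qed.

Lemma gp_sub f g : gp f -> gp g -> gp (fun x => f x - g x).
Proof. by move=> gpf /gp_opp; apply: GPadd. Qed.

Lemma gp_sum (T : Type) (s : seq T) (P : pred T) (F : T -> int -> R) :
  (forall t, gp (F t)) -> gp (fun x => \sum_(t <- s | P t) F t x).
Proof.
move=> gpF; elim: s => [|t s IHs].
  by apply: gp_ext (GPconst 0) => x; rewrite big_nil.
case Pt: (P t).
  by apply: gp_ext (GPadd (gpF t) IHs) => x; rewrite big_cons Pt.
by apply: gp_ext IHs => x; rewrite big_cons Pt.
Qed.

Lemma gp_prod (T : Type) (s : seq T) (P : pred T) (F : T -> int -> R) :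
  (forall t, gp (F t)) -> gp (fun x => \prod_(t <- s | P t) F t x).
Proof.
move=> gpF; elim: s => [|t s IHs].
  by apply: gp_ext (GPconst 1) => x; rewrite big_nil.
case Pt: (P t).
  by apply: gp_ext (GPmul (gpF t) IHs) => x; rewrite big_cons Pt.
by apply: gp_ext IHs => x; rewrite big_cons Pt.
Qed.

Lemma gp_exp f k : gp f -> gp (fun x => f x ^+ k).
Proof.
move=> gpf; apply: gp_ext (gp_prod (index_enum 'I_k) predT (fun=> gpf)) => x.
by rewrite prodr_const card_ord.
Qed.

Lemma gp_mulmx m n l (A : 'M[int]_(m, n)) (B : int -> 'M[int]_(n, l)) :
  (forall i j, gp (fun x => (B x i j)%:~R)) ->
  forall i j, gp (fun x => ((A *m B x) i j)%:~R).
Proof.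
move=> gpB i j; pose F k x : R := (A i k)%:~R * (B x k j)%:~R.
have gpF k : gp (F k) by apply: GPmul => //; apply: GPconst.
apply: gp_ext (gp_sum (index_enum 'I_n) predT gpF) => x.
by rewrite mxE rmorph_sum; apply: eq_bigr => k _; rewrite rmorphM.
Qed.

Lemma gp_det m (A : int -> 'M[int]_m) :
  (forall i j, gp (fun x => (A x i j)%:~R)) -> gp (fun x => (\det (A x))%:~R).
Proof.
move=> gpA.
pose F (s : {perm 'I_m}) x : R :=
  (-1) ^+ s * \prod_(i <- index_enum 'I_m) (A x i (s i))%:~R.
have gpF s : gp (F s).
  by apply: GPmul; [apply: GPconst | apply: gp_prod => i; apply: gpA].
apply: gp_ext (gp_sum (index_enum _) predT gpF) => x.
rewrite /determinant rmorph_sum; apply: eq_bigr => s _.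
by rewrite rmorphM rmorph_sign rmorph_prod.
Qed.

Lemma gpset_setI E E' : gpset E -> gpset E' -> gpset (E `&` E').
Proof.
move=> gpE gpE'; apply: gp_ext (GPmul gpE gpE') => x.
by rewrite !indicE in_setI; case: (x \in E); rewrite ?mul1r ?mul0r.
Qed.

Lemma gpset_setC E : gpset E -> gpset (~` E).
Proof.
move=> gpE; apply: gp_ext (gp_sub (GPconst 1) gpE) => x.
by rewrite !indicE in_setC; case: (x \in E); rewrite ?subrr ?subr0.
Qed.

Lemma gpset_setU E E' : gpset E -> gpset E' -> gpset (E `|` E').
Proof.
move=> gpE gpE'; rewrite -[E `|` E']setCK setCU.
by apply/gpset_setC/gpset_setI; apply: gpset_setC.
Qed.

Lemma irrational_mul (a : R) (b c : int) :
  irrational a -> b%:~R * a = c%:~R -> b = 0.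
Proof.
move=> irr_a bac; apply/eqP/negPn/negP => nz_b; apply: irr_a.
exists (c%:~R / b%:~R) => //; rewrite fmorph_div /= !ratr_int -bac mulrAC.
by rewrite mulfV ?mul1r // intr_eq0.
Qed.

(** If [m] is a nonzero integer then [a m] is not an integer, so the difference
[floor (a m) - a m] lies strictly between [-1] and [0] and its floor is [-1];
for [m = 0] it is [0].  Hence [1 + floor (floor (a f) - a f)] is the indicator
of the zeros of [f]. *)
Lemma gpset_zero (a : R) (f : int -> int) : irrational a ->
  gp (fun x => (f x)%:~R) -> gpset [set x | f x = 0].
Proof.
move=> irr_a gpf.
have gpaf := GPmul gpf (GPconst a).
apply: gp_ext (GPadd (GPconst 1) (GPfloor (gp_sub (GPfloor gpaf) gpaf))) => x.
rewrite indicE; have [fx0|nz_fx] := eqVneq (f x) 0.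
  by rewrite mem_set //= fx0 mul0r floor0 subr0 floor0 addr0.
rewrite memNset /=; last exact/eqP.
set y := _ * a; suff -> : Num.floor ((Num.floor y)%:~R - y) = -1.
  by rewrite subrr.
have /andP[ylo yhi] := floor_itv y.
have nint_y : (Num.floor y)%:~R != y.
  by apply/eqP => /esym /(irrational_mul irr_a) fx0; rewrite fx0 eqxx in nz_fx.
apply/floor_def; move: yhi; rewrite subrr intrD rmorphN1.
by move: ylo; rewrite le_eqVlt (negPf nint_y) /=; lra.
Qed.

(** A one-point set is a zero set, and the rest is a finite union. *)
Lemma gpset_seq (a : R) (s : seq int) (E : set int) : irrational a ->
  (forall x, E x -> x \in s) -> gpset E.
Proof.
move=> irr_a; elim: s E => [|y s IHs] E Es.
  apply: gp_ext (GPconst 0) => x; rewrite indicE memNset // => /Es.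
  by rewrite in_nil.
have gp1 : gpset [set x | x = y].
  have -> : [set x | x = y] = [set x | x - y = 0].
    by apply/seteqP; split => x /=; lia.
  apply: (gpset_zero irr_a); have := gp_sub (@GPid R) (GPconst y%:~R).
  by apply: gp_ext => x; rewrite rmorphB.
have gpE' : gpset (E `\ y).
  by apply: IHs => x /= [/Es]; rewrite inE => /orP[/eqP->|//].
have [Ey|nEy] := asboolP (E y).
  suff -> : E = [set x | x = y] `|` (E `\ y) by apply: gpset_setU.
  apply/seteqP; split => x /=; last by move=> [->|[]].
  by move=> Ex; have [->|/eqP xy] := eqVneq x y; [left | right].
suff -> : E = E `\ y by [].
by apply/seteqP; split => x /= => [Ex|[]//]; split=> // xy; rewrite xy in Ex.
Qed.

Lemma gpset_bounded (a : R) (X : nat) (E : set int) : irrational a ->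
  (forall x, E x -> (absz x < X)%N) -> gpset E.
Proof.
move=> irr_a E_lt; pose s := [seq Posz i | i <- iota 0 X].
apply: (@gpset_seq a (s ++ [seq - x | x <- s]) _ irr_a) => x /E_lt lt_xX.
have s_x : `|x| \in s by rewrite -abszE map_f // mem_iota.
rewrite mem_cat; have [x0|x0] := leP 0 x; first by rewrite -(ger0_norm x0) s_x.
by rewrite -[x]opprK -(ltr0_norm x0) orbC map_f.
Qed.

End GeneralisedPolynomials.

(** * Prescribed phases along a lacunary sequence *)

Lemma nested_intervals_point (R : realType) (l h : nat -> R) :
  (forall n, l n <= l n.+1 /\ h n.+1 <= h n) -> (forall n, l n <= h n) ->
  exists x, forall n, l n <= x <= h n.
Proof.
move=> nested lh; have homo_l m n : (m <= n)%N -> l m <= l n.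
  by apply: (homo_leq (@lexx _ R) (@le_trans _ R)) => i; have [] := nested i.
have homo_h m n : (m <= n)%N -> h n <= h m.
  apply: (homo_leq (r := fun x y => y <= x) (@lexx _ R)) => [y x z xy yz|i].
    exact: le_trans yz xy.
  by have [] := nested i.
have l_le_h i j : l i <= h j.
  have [ij|/ltnW ji] := leqP i j; first exact: le_trans (homo_l _ _ ij) (lh j).
  exact: le_trans (lh i) (homo_h _ _ ji).
exists (sup (range l)) => n; apply/andP; split.
  apply: ub_le_sup; last by exists n.
  by exists (h 0%N) => _ [i _ <-].
by apply: ge_sup; [exists (l 0%N), 0%N | move=> _ [i _ <-]].
Qed.

Section Phases.
Variables (R : realType) (P : pred nat) (a t : nat -> R).

(** The points [x] of [J] with [x * a n - t n] an integer are [1 / a n] apart;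
[c] is the first of them at distance at least [16^-1 / a n] from the left end
of [J], and the new interval consists of the [x] for which [x * a n] is within
[16^-1] of [c * a n].  An interval of width [2 / a n] has room for it. *)
Let phase_step n (J : R * R) : R * R :=
  if P n then
    let c := (t n + (Num.ceil (J.1 * a n + 16^-1 - t n))%:~R) / a n in
    (c - 16^-1 / a n, c + 16^-1 / a n)
  else J.

Let J := fix J n := if n is n'.+1 then phase_step n' (J n') else (0, 2).

(** After step [n] the interval has width [8^-1 / a n], hence width at least
[2 / a n'] for the next index [n'] with [P n'], thanks to the ratio 16: the
construction never gets stuck, and any point common to all the intervals
works. *)
Lemma lacunary_phases :
  (forall n, P n -> 1 <= a n) ->
  (forall n n', P n -> P n' -> (n < n')%N -> 16 * a n <= a n') ->
  exists x, forall n, P n -> exists z : int, `|x * a n - t n - z%:~R| <= 16^-1.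
Proof.
move=> a_ge1 a_lac.
have a_gt0 n : P n -> 0 < a n by move=> /a_ge1; apply: lt_le_trans.
(* The invariant: there is room for the phase of every index still to come. *)
have wide n m : (n <= m)%N -> P m -> 2 <= ((J n).2 - (J n).1) * a m.
  elim: n => [|n IHn] nm Pm /=.
    by rewrite subr0 ler_peMr // a_ge1.
  rewrite /phase_step; case Pn: (P n) => /=; last exact: IHn (ltnW nm) Pm.
  have := a_lac _ _ Pn Pm nm; have := a_gt0 _ Pn; move: (a n) (a m) => b d b0 bd.
  have -> : forall c, (c + 16^-1 / b - (c - 16^-1 / b)) * d = 8^-1 * (d / b).
    by move=> c; field; rewrite gt_eqF.
  have : 16 <= d / b by rewrite ler_pdivlMr.
  lra.
have nested n : [/\ (J n).1 <= (J n.+1).1, (J n.+1).2 <= (J n).2 &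
    P n -> exists c : R, [/\ exists z : int, c * a n - t n = z%:~R,
      (J n.+1).1 = c - 16^-1 / a n & (J n.+1).2 = c + 16^-1 / a n]].
  rewrite /= /phase_step; case Pn: (P n) => //=.
  have := wide n n (leqnn n) Pn; have := a_gt0 _ Pn.
  move: (J n) (a n) => [l h] b b0 /=.
  set k := Num.ceil _; set c := (t n + k%:~R) / b => wide_b.
  have cb : c * b = t n + k%:~R by rewrite /c divfK // gt_eqF.
  have e_b : 16^-1 / b * b = 16^-1 :> R by rewrite divfK // gt_eqF.
  have := ceil_itv (l * b + 16^-1 - t n); rewrite -/k => /andP[klo khi].
  rewrite intrD rmorphN1 in klo.
  split; last 1 first.
  - by exists c; split=> //; exists k; rewrite cb addrAC subrr add0r.
  - by rewrite -(ler_pM2r b0) mulrBl cb e_b; lra.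
  - by rewrite -(ler_pM2r b0) mulrDl cb e_b; lra.
have J_le n : (J n).1 <= (J n).2.
  elim: n => [|n IHn]; first by rewrite /=; lra.
  have [_ _] := nested n; case Pn: (P n); last by move=> _; rewrite /= /phase_step Pn.
  move=> /(_ isT) [c [_ -> ->]].
  have : 0 < 16^-1 / a n by rewrite divr_gt0 ?a_gt0 ?invr_gt0 ?ltr0n.
  lra.
have [|x xJ] := nested_intervals_point (l := fst \o J) (h := snd \o J) _ J_le.
  by move=> n; have [] := nested n.
exists x => n Pn; have [_ _ /(_ Pn) [c [[z cz] Jl Jh]]] := nested n.
have := xJ n.+1; rewrite /comp Jl Jh => /andP[xlo xhi].
exists z; rewrite -cz.
have -> : x * a n - t n - (c * a n - t n) = (x - c) * a n by ring.
rewrite normrM (gtr0_norm (a_gt0 _ Pn)) -ler_pdivlMr ?a_gt0 // ler_norml.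
by apply/andP; split; lra.
Qed.

End Phases.

Lemma expr_unbounded (R : realType) (x M : R) :
  1 < x -> exists n, M <= x ^+ n.
Proof.
move=> x1; exists (Num.bound `|M / (x - 1)|).
set n := Num.bound _.
have : M / (x - 1) < n%:R.
  by apply: le_lt_trans (ler_norm _) _; apply: archi_boundP.
rewrite ltr_pdivrMr ?subr_gt0 // => Mn.
suff bernoulli j : 1 + j%:R * (x - 1) <= x ^+ j by have := bernoulli n; lra.
elim: j => [|j IHj]; first by rewrite expr0; lra.
rewrite exprSr -natr1; have xj : 1 <= x ^+ j by apply: exprn_ege1; exact: ltW.
by nra.
Qed.

(** Choose [th] such that, modulo 1, [th * |x|^k] is close to [1/4] if [|x|] is
in [A], to [-1/4] if [- |x|] is, and to [0] otherwise.  As [k] is odd,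
[th * x^k] is then close to [1/4] exactly for the elements [x] of [A], and to
[0] or [-1/4] for the other elements of [E]: its fractional part after a shift
by [- 1/8] falls in the first or in the second half of the unit interval. *)
Lemma gpset_subset_lacunary (R : realType) (rho : R) (E A : set int) :
  1 < rho ->
  generalised_polynomial_set R E ->
  (forall x, E x -> x != 0) ->
  (forall x y, E x -> E y -> `|x| < `|y| -> rho * `|x|%:~R <= `|y|%:~R) ->
  A `<=` E -> (forall x, A x -> ~ A (- x)) ->
  generalised_polynomial_set R A.
Proof.
move=> rho1 gpE E_neq0 lacE AE asymA.
have [k [odd_k rho_k]] : exists k, odd k /\ 16 <= rho ^+ k.
  have [j rho_j] := expr_unbounded 16 rho1; exists j.*2.+1.
  rewrite /= odd_double -addnn -addSn exprD; split=> //; apply: (le_trans rho_j).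
  by rewrite ler_peMl ?exprn_ege1 ?exprn_ge0 //; lra.
pose P n := `[<exists2 x, E x & n = absz x>].
pose t n : R :=
  if `[<A n%:Z>] then 4^-1 else if `[<A (- n%:Z)>] then - 4^-1 else 0.
have [||th th_phase] := @lacunary_phases R P (fun n => n%:R ^+ k) t.
- move=> n /asboolP[x /E_neq0 x0 ->]; apply: exprn_ege1.
  by rewrite ler1n absz_gt0.
- move=> n n' /asboolP[x Ex ->] /asboolP[y Ey ->] xy.
  have := lacE x y Ex Ey; rewrite -!abszE ltz_nat => /(_ xy).
  rewrite -!pmulrn => le_xy.
  apply: (@le_trans _ _ ((rho * `|x|%:R) ^+ k)).
    by rewrite exprMn ler_wpM2r // exprn_ge0.
  by apply: lerXn2r; rewrite ?nnegrE ?mulr_ge0 //; lra.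
have phase x : E x -> exists z : int, exists tx : R,
    [/\ `|th * x%:~R ^+ k - tx - z%:~R| <= 16^-1, A x -> tx = 4^-1 &
        ~ A x -> tx = 0 \/ tx = - 4^-1].
  move=> Ex; have [|z] := th_phase (absz x); first by apply/asboolP; exists x.
  rewrite /t; have [x_ge0|x_lt0] := leP 0 x.
    rewrite (_ : `|x|%:Z = x); last by rewrite abszE ger0_norm.
    rewrite (_ : `|x|%:R = x%:~R); last by rewrite natr_absz ger0_norm.
    move=> ph; exists z; eexists; split; first exact: ph.
      by move=> Ax; rewrite asboolT.
    by move=> nAx; rewrite asboolF //; case: ifP; [right | left].
  rewrite (_ : `|x|%:Z = - x); last by rewrite abszE ltr0_norm.
  rewrite (_ : `|x|%:R = - x%:~R); last by rewrite natr_absz ltr0_norm // rmorphN.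
  rewrite opprK exprNn -signr_odd odd_k expr1 mulN1r.
  move=> ph; exists (- z); eexists (- (if _ then _ else _)); split.
  - move: ph; rewrite -normrN; apply: le_trans; rewrite le_eqVlt.
    apply/orP; left; apply/eqP; congr `| _ |; rewrite rmorphN /=; ring.
  - by move=> Ax; rewrite asboolF ?asboolT ?opprK // => /asymA; rewrite opprK.
  - move=> nAx; rewrite [`[<A x>]]asboolF //; case: ifP => _; [right|left] => //.
    by rewrite oppr0.
pose g (x : int) : R := th * x%:~R ^+ k - 8^-1.
have gpg : generalised_polynomial g.
  by apply: gp_sub (GPconst _); apply: GPmul (GPconst _) _; apply/gp_exp/GPid.
(* On [E], the floor of [s] is [0] on [A] and [1] off [A]. *)
pose s x : R := 2 * (g x - (Num.floor (g x))%:~R).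
have gps : generalised_polynomial s.
  by apply: GPmul (GPconst _) _; apply: gp_sub => //; apply: GPfloor.
apply: gp_ext (GPmul gpE (gp_sub (GPconst 1) (GPfloor gps))) => x.
rewrite !indicE; have [Ex|nEx] := asboolP (E x); last first.
  by rewrite !memNset ?mul0r // => /AE.
rewrite (mem_set Ex) mul1r.
have [z [tx [+ tA tnA]]] := phase x Ex; rewrite ler_norml => /andP[lo hi].
have [Ax|nAx] := asboolP (A x).
  rewrite (mem_set Ax); move: lo hi; rewrite (tA Ax) => lo hi.
  have gz : Num.floor (g x) = z.
    by apply/floor_def; rewrite intrD mulr1z /g; lra.
  have -> : Num.floor (s x) = 0; last by rewrite subr0.
  by apply/floor_def; rewrite /s gz add0r mulr0z mulr1z /g; lra.
rewrite (memNset nAx).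
have gz : Num.floor (g x) = z - 1.
  apply/floor_def; rewrite subrK intrD rmorphN1 /g.
  by case: (tnA nAx) => tE; lra.
have -> : Num.floor (s x) = 1; last by rewrite subrr.
apply/floor_def; rewrite /s gz intrD rmorphN1 intrD mulr1z /g.
by case: (tnA nAx) => tE; lra.
Qed.

(** * Minimal polynomials of algebraic integers and of units *)

Local Notation zpoly q := (map_poly intr (q : {poly int})).

Lemma map_ratr_zpoly (F : numFieldType) (q : {poly int}) :
  map_poly (ratr : rat -> F) (zpoly q) = zpoly q.
Proof.
by rewrite -map_poly_comp; apply: eq_map_poly => z /=; rewrite ratr_int.
Qed.

Section MinimalPolynomial.
Variables (F : numFieldType) (x : F) (p : {poly rat}).
Hypothesis min_p : minimal_polynomial x p.

Let mon_p : p \is monic. Proof. by case: min_p. Qed.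
Let root_p : root (map_poly ratr p) x. Proof. by case: min_p. Qed.

Lemma minimal_polynomial_dvd q : root (map_poly ratr q) x -> p %| q.
Proof.
move=> qx; have rx : root (map_poly ratr (q %% p)) x.
  move: qx; rewrite {1}(divp_eq q p) rmorphD rmorphM /= /root hornerD hornerM.
  by rewrite (rootP root_p) mulr0 add0r.
rewrite /dvdp; apply/negPn/negP => nz_r.
have [_ _ /(_ _ nz_r rx)] := min_p.
by rewrite leqNgt ltn_modp monic_neq0.
Qed.

(** Gauss's lemma: [p] divides a monic integer polynomial [h], hence is
proportional to an integer factor [p1] of [h], whose leading coefficient
divides that of [h] and so is a unit. *)
Lemma minimal_polynomial_int :
  integralOver (intr : int -> F) x -> exists2 P : {poly int}, P \is monic & p = zpoly P.
Proof.
case=> h mon_h hx.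
have [|p1 [a nz_a pE] [r hE]] := @dvdpP_rat_int p h.
  by apply: minimal_polynomial_dvd; rewrite map_ratr_zpoly.
have lc1 : lead_coef p1 * lead_coef r = 1.
  by rewrite -lead_coefM -hE; apply/eqP.
have u1 : lead_coef p1 \is a GRing.unit.
  by apply/unitrPr; exists (lead_coef r).
have lcsq : lead_coef p1 * lead_coef p1 = 1.
  by move: u1; rewrite qualifE /= => /orP[] /eqP ->.
have a1 : a * (lead_coef p1)%:~R = 1.
  have := monicP mon_p; rewrite pE lead_coefZ lead_coef_map_inj //.
  exact: intr_inj.
exists (lead_coef p1 *: p1); first by rewrite monicE lead_coefZ lcsq.
rewrite map_polyZ pE; congr (_ *: _).
by rewrite -[LHS]mulr1 -(rmorph1 intr) -lcsq rmorphM mulrA a1 mul1r.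
Qed.

(** By minimality [x] is not a root of the derivative of [p], so it is not a root
of the gcd of [p] and its derivative; it is then a root of the cofactor, which
by minimality again has the size of [p]. *)
Lemma minimal_polynomial_separable : separable_poly p.
Proof.
have p'x : ~~ root (map_poly ratr p^`()) x.
  apply/negP => p'x; have : p^`() != 0.
    apply/eqP => p'0; have := @root_size_gt1 _ x (map_poly ratr p).
    rewrite map_poly_eq0 monic_neq0 // root_p size_map_poly => /(_ isT isT) sz_p.
    have := congr1 (fun q : {poly rat} => q`_(size p).-2) p'0.
    have e : (size p).-2.+1 = (size p).-1.
      by case: (size p) sz_p => [|[]].
    rewrite coef_deriv coef0 e.
    move=> /eqP; rewrite mulrn_eq0 -lead_coefE (monicP mon_p) oner_eq0 orbF -e.
    by [].
  move=> nz_p'; have [_ _ /(_ _ nz_p' p'x)] := min_p.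
  by rewrite leqNgt lt_size_deriv // monic_neq0.
rewrite unlock; have := dvdp_gcdl p p^`(); set g := gcdp _ _ => /dvdpP[h ph].
have gx : ~~ root (map_poly ratr g) x.
  apply: contra p'x; have /dvdpP[k ->] := dvdp_gcdr p p^`().
  by rewrite -/g rmorphM rootM orbC => ->.
have hx : root (map_poly ratr h) x.
  by move: root_p; rewrite ph rmorphM rootM (negPf gx) orbF.
have nz_h : h != 0.
  by apply: contraTneq (monic_neq0 mon_p); rewrite ph => ->; rewrite mul0r eqxx.
have nz_g : g != 0.
  by apply: contraTneq (monic_neq0 mon_p); rewrite ph => ->; rewrite mulr0 eqxx.
have [_ _ /(_ _ nz_h hx)] := min_p.
rewrite {1}ph size_mul // /coprimep -/g.
move: nz_h nz_g; rewrite -!size_poly_eq0.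
by case: (size h) => // a; case: (size g) => [//|b] _ _; lia.
Qed.


Lemma minimal_polynomial_dvdz (P q : {poly int}) :
  P \is monic -> p = zpoly P -> root (zpoly q) x -> exists r, q = P * r.
Proof.
move=> mon_P pE qx; have : p %| zpoly q.
  by apply: minimal_polynomial_dvd; rewrite map_ratr_zpoly.
rewrite pE dvdp_rat_int => /dvdpP_int[r ->].
by exists r; rewrite zprimitive_monic.
Qed.

(** The reciprocal of a monic integer polynomial vanishing at [x^-1] vanishes at
[x], so it is a multiple of [P], and its constant coefficient is 1. *)
Lemma minimal_polynomial_const (P : {poly int}) :
  P \is monic -> p = zpoly P -> x != 0 -> integralOver (intr : int -> F) x^-1 ->
  P`_0 * P`_0 = 1.
Proof.
move=> mon_P pE nz_x [h mon_h hx].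
pose d := (size h).-1; pose hr := \poly_(i < d.+1) h`_(d - i).
have sz_h : size h = d.+1 by rewrite /d prednK // size_poly_gt0 monic_neq0.
have hr_x : root (zpoly hr) x.
  apply/eqP; have: (zpoly h).[x^-1] * x ^+ d = 0.
    by rewrite (rootP hx) mul0r.
  rewrite (horner_coef_wide (n := d.+1)); last first.
    by apply: leq_trans (size_poly _ _) _; rewrite sz_h.
  rewrite (horner_coef_wide (n := d.+1)); last first.
    by apply: leq_trans (size_poly _ _) _; rewrite size_poly.
  rewrite big_distrl (reindex_inj rev_ord_inj) /=; apply: etrans.
  apply: eq_bigr => i _; rewrite !coef_map coef_poly ltn_ord subSS.
  have le_id : (i <= d)%N by rewrite -ltnS.
  have -> : x ^+ d = x ^+ (d - i) * x ^+ i by rewrite -exprD subnK.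
  by rewrite exprVn mulrA mulfVK // expf_neq0.
have [r hrE] := minimal_polynomial_dvdz mon_P pE hr_x.
have : hr`_0 = P`_0 * r`_0 by rewrite hrE coef0M.
rewrite coef_poly /= subn0 -lead_coefE (monicP mon_h) => P0r0.
have : P`_0 \is a GRing.unit by apply/unitrPr; exists r`_0.
by rewrite qualifE /= => /orP[] /eqP ->.
Qed.

End MinimalPolynomial.

(** * Geometric decay of linear recurrences *)

(** The action of [F[X]] on sequences in which ['X] is the shift; sequences with
characteristic polynomial [q] are those killed by [q]. *)
Definition poly_shift (F : comNzRingType) (q : {poly F}) (u : nat -> F) (i : nat) :=
  \sum_(j < size q) q`_j * u (i + j)%N.

Lemma poly_shift_wide (F : comNzRingType) n (q : {poly F}) u i :
  (size q <= n)%N -> poly_shift q u i = \sum_(j < n) q`_j * u (i + j)%N.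
Proof.
move=> le_qn; rewrite /poly_shift (big_ord_widen n (fun j => q`_j * u (i + j)%N)) //.
rewrite big_mkcond; apply: eq_bigr => j _.
by case: ltnP => // /(nth_default 0) ->; rewrite mul0r.
Qed.

Lemma poly_shift_mulXsubC (F : comNzRingType) (q : {poly F}) a u i :
  poly_shift (q * ('X - a%:P)) u i =
  poly_shift q (fun j => u j.+1 - a * u j) i.
Proof.
rewrite (@poly_shift_wide _ (size q).+1); last first.
  by apply: leq_trans (size_polyMleq _ _) _; rewrite size_XsubC addn2.
rewrite mulrBr; under eq_bigr do rewrite coefB coefMX coefMC mulrBl.
rewrite sumrB big_ord_recl mul0r add0r big_ord_recr /= nth_default // mul0r mul0r addr0.
rewrite -sumrB; apply: eq_bigr => j _ /=.
by rewrite /bump add1n addnS; ring.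
Qed.

(** The constant [L] in front of [r ^+ i] is chosen to dominate [|w 0|] and to
satisfy [|a| L + K <= r L], which is what the induction requires. *)
Lemma geometric_decay_step (F : numFieldType) (a : F) (w : nat -> F) (r K : F) :
  0 <= r -> 0 <= K -> `|a| < r -> (forall i, `|w i.+1 - a * w i| <= K * r ^+ i) ->
  forall i, `|w i| <= (`|w 0%N| + K / (r - `|a|)) * r ^+ i.
Proof.
move=> r0 K0 ar wK; set L := _ + _.
have ra : 0 < r - `|a| by rewrite subr_gt0.
elim=> [|i IHi]; first by rewrite expr0 mulr1 lerDl divr_ge0 // ltW.
rewrite -(subrK (a * w i) (w i.+1)); apply: le_trans (ler_normD _ _) _.
apply: (@le_trans _ _ (K * r ^+ i + `|a| * (L * r ^+ i))).
  by rewrite lerD // normrM ler_wpM2l.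
rewrite exprS !mulrA -mulrDl (mulrC L) ler_wpM2r ?exprn_ge0 //.
rewrite -lerBrDr -mulrBl /L mulrDr [_ * (K / _)]mulrC divfK ?gt_eqF // lerDr.
by rewrite mulr_ge0 // ltW.
Qed.

(** Factors ['X - a] are removed one at a time.  The rate is raised
strictly above [|a|] at each step, so repeated roots are harmless. *)
Lemma geometric_decay (F : numFieldType) (s : seq F) (w : nat -> F) :
  (forall a, a \in s -> `|a| < 1) ->
  (forall i, poly_shift (\prod_(a <- s) ('X - a%:P)) w i = 0) ->
  exists r K : F, [/\ 0 <= r, r < 1, 0 <= K & forall i, `|w i| <= K * r ^+ i].
Proof.
elim: s w => [|a s IHs] w s1 w0.
  exists 0, 0; split=> // i; have := w0 i.
  by rewrite big_nil /poly_shift size_poly1 big_ord1 coef1 mul1r addn0 => ->; rewrite normr0 mul0r.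
have a1 : `|a| < 1 by apply: s1; rewrite mem_head.
have [||r [K [r0 r1 K0 wK]]] := IHs (fun j => w j.+1 - a * w j).
- by move=> b sb; apply: s1; rewrite in_cons sb orbT.
- by move=> i; rewrite -(w0 i) big_cons mulrC poly_shift_mulXsubC.
(* This [r'] lies strictly between [max r |a|] and 1. *)
pose r' := 1 - (1 - r) * (1 - `|a|) / 2.
have r1' : 0 < 1 - r by rewrite subr_gt0.
have a1' : 0 < 1 - `|a| by rewrite subr_gt0.
have rr' : r < r'.
  rewrite ltrBrDl -ltrBrDr ltr_pdivrMr // ltr_pM2l //.
  by apply: (@le_lt_trans _ _ 1); rewrite ?gerBl // ltr1n.
have ar' : `|a| < r'.
  rewrite ltrBrDl -ltrBrDr ltr_pdivrMr // mulrC ltr_pM2l //.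
  by apply: (@le_lt_trans _ _ 1); rewrite ?gerBl // ltr1n.
have r'0 : 0 <= r' := le_trans r0 (ltW rr').
exists r', (`|w 0%N| + K / (r' - `|a|)); split=> //.
- by rewrite gtrBl divr_gt0 // mulr_gt0.
- by rewrite addr_ge0 // divr_ge0 // subr_ge0 ltW.
apply: geometric_decay_step => // i; apply: le_trans (wK i) _.
by rewrite ler_wpM2l // lerXn2r ?nnegrE // ltW.
Qed.

Lemma normc_realE (R : realType) (x : R) : `|(x%:C)%C| = (`|x|%:C)%C.
Proof. by rewrite normc_def /= expr0n addr0 sqrtr_sqr. Qed.

Lemma complex_ge0P (R : realType) (z : R[i]) : 0 <= z -> exists2 x : R, 0 <= x & z = (x%:C)%C.
Proof.
case: z => a b; rewrite lecE /= => /andP[/eqP -> a0]; exists a => //.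
Qed.

Lemma geometric_decay_real (R : realType) (s : seq R[i]) (w : nat -> R) :
  (forall a, a \in s -> `|a| < 1) ->
  (forall i, poly_shift (\prod_(a <- s) ('X - a%:P)) (fun j => ((w j)%:C)%C) i = 0) ->
  exists r K : R, [/\ 0 <= r, r < 1, 0 <= K & forall i, `|w i| <= K * r ^+ i].
Proof.
move=> s1 /(geometric_decay s1)[r [K [r0 r1 K0 wK]]].
have [x x0 rx] := complex_ge0P r0; have [L L0 KL] := complex_ge0P K0.
exists x, L; split=> //; first by rewrite -ltcR -rx.
by move=> i; have := wK i; rewrite normc_realE rx KL -rmorphXn -rmorphM lecR.
Qed.

(** * Bounding the divisors of an integer in a ring of unit rank one *)

(** In a multiplicative relation between [u] and [v] the exponent of [u] is
nonzero, as [v] has infinite order; the sign of the exponent of [v] decides on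
which side of the equation it is put. *)
Lemma rank1_dependence (F : fieldType) (G : set F) (u v : F) :
  mul_rank G 1 -> G u -> G v -> u != 0 -> v != 0 ->
  (forall e : int, v ^ e = 1 -> e = 0) ->
  exists a b c : nat, (0 < a)%N /\ u ^+ a * v ^+ b = v ^+ c.
Proof.
move=> [_ rk1] Gu Gv nz_u nz_v v_free.
pose f (i : 'I_2) := if i == 0 then u else v.
have Gf i : G (f i) by rewrite /f; case: ifP.
have /existsNP[e /not_implyP[fe1 /existsNP[i nz_ei]]] : ~ mul_independent f.
  by move=> /(rk1 2%N f Gf).
move: fe1; rewrite big_ord_recl big_ord1 /f /=.
set e0 := e ord0; set e1 := e _ => uv1.
have nz_e0 : e0 != 0.
  apply: contra_notN nz_ei => /eqP e00; move: uv1; rewrite e00 expr0z mul1r.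
  move=> /v_free e10; case: i => -[|[|//]] lt_i2.
    by rewrite -e00 /e0; congr (e _); apply: val_inj.
  by rewrite -e10 /e1; congr (e _); apply: val_inj.
have uvE : u ^ e0 = v ^ (- e1).
  by apply: (mulIf (expfz_neq0 e1 nz_v)); rewrite uv1 -expfzDr // addNr expr0z.
wlog e0_gt0 : e0 e1 {uv1} nz_e0 uvE / 0 < e0.
  move=> W; have [e0_gt0|] := ltP 0 e0; first exact: (W e0 e1).
  rewrite le_eqVlt (negPf nz_e0) /= => e0_lt0.
  apply: (W (- e0) (- e1)); rewrite ?oppr_eq0 ?oppr_gt0 //.
  by rewrite -invr_expz uvE invr_expz.
exists (absz e0).
have uE : u ^+ `|e0| = u ^ e0 by rewrite exprnP gez0_abs // ltW.
have [e1_le0|e1_gt0] := leP e1 0.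
  exists 0%N, (absz e1); split; first by rewrite absz_gt0.
  by rewrite mulr1 uE uvE exprnP abszE ler0_norm.
exists (absz e1), 0%N; split; first by rewrite absz_gt0.
by rewrite uE uvE exprnP abszE gtr0_norm // -expfzDr // addNr.
Qed.

Lemma finite_gap (R : realType) (T : finType) (f : T -> R) (b : R) : 1 < b ->
  exists2 rho, 1 < rho <= b & forall t, 1 < f t -> rho <= f t.
Proof.
move=> b1; exists (\big[Order.min/b]_(t | 1 < f t) f t).
  by rewrite bigmin_le_id andbT; apply/bigmin_gtP; split.
by move=> t ft; apply: bigmin_le_cond.
Qed.

Lemma bound_by_classes (F : numDomainType) (X : Type) (T : finType) (G : X -> Prop)
    (cls : X -> T) (f : X -> F) :
  (forall x, 0 <= f x) ->
  (forall x0, G x0 -> exists B, forall x, G x -> cls x = cls x0 -> f x <= B) ->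
  exists B, forall x, G x -> f x <= B.
Proof.
move=> f0 bnd.
have /choice[B BP] : forall t, exists B, 0 <= B /\
    forall x, G x -> cls x = t -> f x <= B.
  move=> t; have [[x0 [Gx0 <-]]|none] := pselect (exists x0, G x0 /\ cls x0 = t).
    have [B BP] := bnd _ Gx0; exists B; split=> //.
    exact: le_trans (f0 x0) (BP x0 Gx0 erefl).
  by exists 0; split=> // x Gx xt; case: none; exists x.
exists (\sum_t B t) => x Gx; rewrite (bigD1 (cls x)) //=.
have [_ /(_ x Gx erefl)] := BP (cls x).
by move/le_trans; apply; rewrite lerDl sumr_ge0 // => t _; have [] := BP t.
Qed.

Section RankOne.
Variables (R : realType) (beta : R) (P : {poly int}) (rs : seq R[i]).
Hypotheses (beta_gt1 : 1 < beta) (mon_P : P \is monic).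
Hypothesis dvd_P : forall q : {poly int}, root (zpoly q) beta -> exists r, q = P * r.
Hypothesis root_P : root (zpoly P) beta.
Hypothesis P0 : P`_0 * P`_0 = 1.
Hypotheses (uniq_rs : uniq rs) (P_rs : zpoly P = \prod_(z <- rs) ('X - z%:P)).
Hypothesis rank1 : mul_rank (unit_group (ring_of_integers (Q_adjoin beta))) 1.
Hypothesis int_beta : algebraic_integer beta.

Local Notation ev q := ((zpoly q).[beta]).

Let beta_gt0 : 0 < beta := lt_trans ltr01 beta_gt1.
Let nz_beta : beta != 0. Proof. by rewrite gt_eqF. Qed.

Lemma evM q r : ev (q * r) = ev q * ev r.
Proof. by rewrite rmorphM hornerM. Qed.

(** Conjugation [beta -> z] is well defined on [Z[beta]]: a relation between
polynomial expressions in [beta] persists at [z]. *)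
Lemma conj_root q z : ev q = 0 -> z \in rs -> (zpoly q).[z] = 0.
Proof.
move=> /eqP /dvd_P[r ->] rs_z; rewrite rmorphM hornerM /= P_rs.
by move: rs_z; rewrite -root_prod_XsubC => /rootP ->; rewrite mul0r.
Qed.

(** From [P(beta) = 0] one gets [beta * ((P - P`_0) / 'X)(beta) = - P`_0], and
[P`_0] is its own inverse. *)
Definition poly_beta_inv : {poly int} := - P`_0 *: drop_poly 1 P.

Lemma ev_beta_inv : ev poly_beta_inv = beta^-1.
Proof.
apply: (mulfI nz_beta); rewrite mulfV // /poly_beta_inv.
rewrite map_polyZ hornerZ mulrCA.
have := rootP root_P; rewrite -[in zpoly P](poly_take_drop 1 P).
have -> : take_poly 1 P = (P`_0)%:P.
  by apply/polyP => -[|i]; rewrite coef_take_poly coefC.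
rewrite expr1 rmorphD rmorphM /= map_polyX map_polyC /= hornerD hornerM hornerC hornerX.
rewrite mulrC => /(canRL (addKr _)); rewrite addr0 => ->.
by rewrite rmorphN mulrNN -rmorphM P0.
Qed.

Lemma conj_neq0 z : z \in rs -> z != 0.
Proof.
move=> rs_z; have : ev ('X * poly_beta_inv - 1) = 0.
  rewrite rmorphB rmorphM /= rmorph1 map_polyX hornerD hornerM hornerN hornerX.
  by rewrite hornerC ev_beta_inv mulfV // subrr.
move=> /conj_root /(_ rs_z) H; apply: contra_eq_neq H => ->.
rewrite rmorphB rmorphM /= rmorph1 map_polyX hornerD hornerM hornerN hornerX.
by rewrite hornerC mul0r sub0r oppr_eq0 oner_eq0.
Qed.

Lemma ev_integral q : algebraic_integer (ev q).
Proof.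
apply: integral_horner => //; apply/integral_poly => i.
by rewrite coef_map; apply: integral_id.
Qed.

Lemma ev_unit w w' : ev w * ev w' = 1 ->
  unit_group (ring_of_integers (Q_adjoin beta)) (ev w).
Proof.
have Q q : ring_of_integers (Q_adjoin beta) (ev q).
  split; last exact: ev_integral.
  exists (zpoly q), 1; rewrite map_ratr_zpoly rmorph1 hornerC divr1.
  by rewrite oner_neq0.
move=> ww'; have nz_w : ev w != 0.
  by apply: contra_eq_neq ww' => ->; rewrite mul0r eq_sym oner_eq0.
split=> //; suff <- : ev w' = (ev w)^-1 by [].
by apply: (mulfI nz_w); rewrite ww' mulfV.
Qed.

(** A relation [u^a beta^b = beta^c] with [beta^-2 < |u| < beta^2] forces
[|c - b| < 2 a].  Its conjugate at [z] gives [|u_z| = |z|^((c - b) / a)], so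
[|u_z|] lies between [|z|^2] and [|z|^-2]; the sum is a bound in both cases
[|z| <= 1] and [1 <= |z|]. *)
Lemma unit_conj_bound w w' z : z \in rs -> ev w * ev w' = 1 ->
  `|ev w| < beta ^+ 2 -> 1 < `|ev w| * beta ^+ 2 ->
  `|(zpoly w).[z]| <= `|z| ^+ 2 + `|z| ^- 2.
Proof.
move=> rs_z ww' w_lt w_gt.
have [nz_w _ _] := ev_unit ww'.
have Gbeta : unit_group (ring_of_integers (Q_adjoin beta)) beta.
  have := @ev_unit 'X poly_beta_inv.
  by rewrite map_polyX hornerX ev_beta_inv mulfV //; apply.
have [|a [b [c [a_gt0 wE]]]] := rank1_dependence rank1 (ev_unit ww') Gbeta nz_w nz_beta.
  by move=> e /eqP; rewrite pexprz_eq1 ?ltW // (gt_eqF beta_gt1) orbF => /eqP.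
have normE : `|ev w| ^+ a * beta ^+ b = beta ^+ c.
  by rewrite -[RHS]gtr0_norm ?exprn_gt0 // -wE normrM !normrX (gtr0_norm beta_gt0).
have c_lt : (c < 2 * a + b)%N.
  rewrite -(ltr_eXn2l beta_gt1) -normE exprD ltr_pM2r ?exprn_gt0 //.
  by rewrite exprM ltrXn2r ?nnegrE // ?exprn_ge0 ?(ltW beta_gt0) // -lt0n.
have b_lt : (b < c + 2 * a)%N.
  rewrite -(ltr_eXn2l beta_gt1) exprD -normE mulrAC exprM -exprMn.
  by rewrite ltr_pMl ?exprn_gt0 // exprn_egt1 // -lt0n.
have conjE : (zpoly w).[z] ^+ a * z ^+ b = z ^+ c.
  have : ev (w ^+ a * 'X^b - 'X^c) = 0.
    by rewrite rmorphB rmorphM !rmorphXn /= map_polyX !hornerE wE subrr.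
  move=> /conj_root /(_ rs_z).
  by rewrite rmorphB rmorphM !rmorphXn /= map_polyX !hornerE => /subr0_eq.
have {conjE} := congr1 Num.norm conjE; rewrite normrM !normrX.
move: (`|_.[z]|) (normr_ge0 (zpoly w).[z]) => W W0.
have : 0 < `|z| by rewrite normr_gt0 conj_neq0.
move: `|z| (normr_real z) => A Areal A0 WA.
have Ai0 : 0 < A ^- 2 by rewrite invr_gt0 exprn_gt0.
have A20 : 0 < A ^+ 2 by rewrite exprn_gt0.
rewrite -(ler_pXn2r a_gt0) ?nnegrE ?addr_ge0 ?(ltW A20) ?(ltW Ai0) //=.
have Ab := exprn_gt0 b A0.
rewrite -(ler_pM2r Ab) WA.
have [A1|/ltW A1] := real_leP Areal (real1 _).
  have le_a : A ^- 2 ^+ a <= (A ^+ 2 + A ^- 2) ^+ a.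
    by apply: lerXn2r; rewrite ?nnegrE ?addr_ge0 ?lerDr ?(ltW A20) ?(ltW Ai0).
  apply: le_trans (ler_wpM2r (ltW Ab) le_a).
  have A2a : 0 < A ^+ (2 * a) by apply: exprn_gt0.
  rewrite exprVn -exprM ler_pdivlMl // -exprD.
  by apply: ler_wiXn2l; rewrite ?(ltW A0) // addnC ltnW.
have le_a : A ^+ 2 ^+ a <= (A ^+ 2 + A ^- 2) ^+ a.
  by apply: lerXn2r; rewrite ?nnegrE ?addr_ge0 ?lerDl ?(ltW A20) ?(ltW Ai0).
apply: le_trans (ler_wpM2r (ltW Ab) le_a).
rewrite -exprM -exprD; apply: ler_weXn2l => //.
exact: ltnW.
Qed.


Definition divides_const (N : int) (q : {poly int}) : Prop :=
  exists h : {poly int}, ev q * ev h = N%:~R.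

(** If [q = q0 + N g] and [N = q0 h0] at [beta], then [q = q0 (1 + h0 g)]:
congruent divisors of [N] divide each other, so their quotient is a unit. *)
Lemma congruent_conj_bound N q q0 z : N != 0 -> z \in rs ->
  divides_const N q -> divides_const N q0 ->
  (forall i, (q`_i = q0`_i %[mod N])%Z) ->
  1 <= `|ev q| < beta ^+ 2 -> 1 <= `|ev q0| < beta ^+ 2 ->
  `|(zpoly q).[z]| <= `|(zpoly q0).[z]| * (`|z| ^+ 2 + `|z| ^- 2).
Proof.
move=> nz_N rs_z [h qh] [h0 qh0] eq_mod /andP[q_ge q_lt] /andP[q0_ge q0_lt].
pose d := maxn (size q) (size q0).
pose g : {poly int} := \poly_(i < d) ((q`_i - q0`_i) %/ N)%Z.
have qE : q = q0 + N *: g.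
  apply/polyP => i; rewrite coefD coefZ coef_poly.
  case: ltnP => [_|]; last first.
    rewrite geq_max => /andP[sq sq0].
    by rewrite (nth_default 0 sq) (nth_default 0 sq0) mulr0 addr0.
  have dvd_N : (N %| q`_i - q0`_i)%Z by rewrite -eqz_mod_dvd; apply/eqP/eq_mod.
  by rewrite mulrC (divzK dvd_N) addrCA subrr addr0.
have q_gt0 : 0 < `|ev q| by apply: lt_le_trans q_ge.
have q0_gt0 : 0 < `|ev q0| by apply: lt_le_trans q0_ge.
have nz_q : ev q != 0 by rewrite -normr_gt0.
have nz_q0 : ev q0 != 0 by rewrite -normr_gt0.
have evq : ev q = ev q0 + N%:~R * ev g.
  by rewrite {1}qE rmorphD /= map_polyZ hornerD hornerZ.
have w1 : ev q0 * ev (1 + h0 * g) = ev q.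
  by rewrite rmorphD rmorphM rmorph1 /= !hornerE mulrDr mulr1 mulrA qh0 evq.
have w2 : ev q * ev (1 - h * g) = ev q0.
  rewrite rmorphB rmorphM rmorph1 /= !hornerE mulrBr mulr1 mulrA qh evq.
  by rewrite addrK.
have ww' : ev (1 + h0 * g) * ev (1 - h * g) = 1.
  by apply: (mulfI nz_q0); rewrite mulrA w1 w2 mulr1.
have q_conj : (zpoly q).[z] = (zpoly q0).[z] * (zpoly (1 + h0 * g)).[z].
  apply/subr0_eq; rewrite -hornerM -hornerN -hornerD -rmorphM -rmorphB.
  by apply: conj_root => //; rewrite rmorphB hornerD hornerN evM w1 subrr.
rewrite q_conj normrM ler_wpM2l //; apply: unit_conj_bound ww' _ _ => //.
  rewrite -(ltr_pM2l q0_gt0) -normrM w1.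
  by apply: lt_le_trans q_lt _; rewrite ler_peMl // exprn_ge0 // ltW.
rewrite -(ltr_pM2l q0_gt0) mulr1 mulrA -normrM w1.
by apply: lt_le_trans q0_lt _; rewrite ler_peMl // exprn_ge0 // ltW.
Qed.

Let m := size rs.

Lemma size_P : size P = m.+1.
Proof.
have : size (zpoly P : {poly R[i]}) = size P.
  by rewrite size_map_inj_poly //; apply: intr_inj.
by rewrite P_rs size_prod_XsubC.
Qed.

Lemma reduce_mod_P q : exists2 q1 : {poly int}, (size q1 <= m)%N & ev q1 = ev q.
Proof.
exists (Pdiv.Ring.rmodp q P).
  by rewrite -ltnS -size_P Pdiv.Ring.ltn_rmodp monic_neq0.
rewrite [in RHS](Pdiv.RingMonic.rdivp_eq mon_P q) rmorphD rmorphM /= hornerD hornerM.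
by rewrite (rootP root_P) mulr0 add0r.
Qed.

Let small (N : int) (q : {poly int}) : Prop :=
  [/\ (size q <= m)%N, divides_const N q & 1 <= `|ev q| < beta ^+ 2].

Lemma small_conj_bounded (N : int) : N != 0 -> exists B : R[i], forall q, small N q ->
  forall z, z \in rs -> `|(zpoly q).[z]| <= B.
Proof.
move=> nz_N.
pose cls (q : {poly int}) : {ffun 'I_m -> 'I_(absz N).+1} :=
  [ffun i : 'I_m => inord (absz (q`_i %% N)%Z)].
have [|q0 [sz_q0 Dq0 q0_b]|B BP] :=
  @bound_by_classes _ _ _ (small N) cls (fun q => \sum_(z <- rs) `|(zpoly q).[z]|).
- by move=> q; apply: sumr_ge0.
- exists (\sum_(z <- rs) `|(zpoly q0).[z]| * (`|z| ^+ 2 + `|z| ^- 2)).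
  move=> q [sz_q Dq q_b] /ffunP eq_cls.
  rewrite big_seq [leRHS]big_seq; apply: ler_sum => z rs_z.
  apply: congruent_conj_bound Dq Dq0 _ q_b q0_b => // i.
  have [lt_im|le_mi] := ltnP i m; last first.
    by rewrite !nth_default // (leq_trans _ le_mi).
  have := eq_cls (Ordinal lt_im); rewrite !ffunE => /(congr1 val).
  have lt_mod (a : int) : (absz (a %% N)%Z < (absz N).+1)%N.
    by rewrite ltnS -lez_nat gez0_abs ?modz_ge0 // ltW // ltz_mod.
  rewrite /= !inordK // => /(congr1 Posz).
  by rewrite !gez0_abs ?modz_ge0.
exists B => q /BP le_B z rs_z; apply: le_trans le_B.
by rewrite (big_rem z) //= lerDl sumr_ge0.
Qed.

(** The values of [q] at the conjugates are the product of its coefficient vector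
with the Vandermonde matrix of the conjugates, invertible as they are
distinct. *)
Lemma coef_conj_bound : exists V : R[i], forall (q : {poly int}) (B : R[i]),
  (size q <= m)%N -> (forall z, z \in rs -> `|(zpoly q).[z]| <= B) ->
  forall i, `|(q`_i)%:~R : R[i]| <= V * B.
Proof.
pose a : 'rV[R[i]]_m := \row_j rs`_j; pose V := Vandermonde m a.
have V_unit : V \in unitmx.
  rewrite unitmxE det_Vandermonde unitfE.
  apply/prodf_neq0 => i _; apply/prodf_neq0 => j lt_ij.
  by rewrite !mxE subr_eq0 nth_uniq // gtn_eqF.
exists (\sum_i \sum_j `|invmx V i j|) => q B sz_q qB i.
have [le_mi|lt_im] := leqP m i.
  rewrite nth_default ?(leq_trans sz_q) // normr0.
  case: (posnP m) => [m0|m_gt0].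
    rewrite big1 ?mul0r // => j _; have := ltn_ord j; by rewrite {2}m0.
  rewrite mulr_ge0 //; first by do 2!apply: sumr_ge0 => ? _.
  exact: le_trans (normr_ge0 _) (qB _ (mem_nth 0 m_gt0)).
pose c : 'rV[R[i]]_m := \row_j (q`_j)%:~R.
pose v : 'rV[R[i]]_m := \row_j (zpoly q).[rs`_j].
have cV : c *m V = v.
  apply/rowP => j; rewrite !mxE (horner_coef_wide (n := m)); last first.
    by apply: leq_trans (size_poly _ _) _.
  by apply: eq_bigr => k _; rewrite !mxE coef_map.
have -> : (q`_i)%:~R = (v *m invmx V) 0 (Ordinal lt_im).
  by rewrite -cV mulmxK // mxE.
rewrite mxE; apply: le_trans (ler_norm_sum _ _ _) _.
rewrite mulr_suml; apply: ler_sum => k _.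
have vB : `|v 0 k| <= B by rewrite mxE; apply: qB; apply: mem_nth.
rewrite normrM mulrC; apply: ler_pM => //.
by rewrite (bigD1 (Ordinal lt_im)) //= lerDl sumr_ge0.
Qed.

Lemma small_coef_bounded (N : int) : N != 0 -> exists B : nat, forall q, small N q ->
  forall i, (absz (q`_i)%R <= B)%N.
Proof.
move=> nz_N; have [K KP] := small_conj_bounded nz_N.
have [V VP] := coef_conj_bound.
exists (Num.bound (complex.Re (V * K))) => q sm_q i.
have [sz_q _ _] := sm_q; have := VP q K sz_q (KP q sm_q) i.
rewrite -intr_norm -abszE -pmulrn => le_VK.
have VK0 : 0 <= V * K := le_trans (ler0n _ _) le_VK.
have [x x0 VKx] := complex_ge0P VK0; move: le_VK; rewrite VKx /=.
rewrite -(rmorph_nat (real_complex R)) lecR => le_x.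
by rewrite -(ler_nat R) ltW // (le_lt_trans le_x) // archi_boundP.
Qed.

(** Multiplication by a power of [beta^-1] brings the value of [q]
between 1 and [beta].  Then either the ratio is at least [beta], or both values
lie between 1 and [beta^2], where only finitely many ratios occur. *)
Lemma value_gap (N : int) : N != 0 -> exists2 rho : R, 1 < rho &
  forall q q', divides_const N q -> divides_const N q' ->
    1 <= `|ev q| -> `|ev q| < `|ev q'| -> rho * `|ev q| <= `|ev q'|.
Proof.
move=> nz_N; have [B BP] := small_coef_bounded nz_N.
pose T := {ffun 'I_m -> 'I_(B + B).+1}.
pose val_T (t : T) : R := `|\sum_(i < m) ((t i)%:Z - B%:Z)%:~R * beta ^+ i|.
(* The shift by [B] turns coefficients bounded by [B] into indices. *)
have T_small q : small N q -> exists t, `|ev q| = val_T t.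
  move=> sm_q; have qB := BP q sm_q; have [sz_q _ _] := sm_q.
  exists [ffun i : 'I_m => inord (absz (q`_i + B%:Z))]; congr `| _ |.
  rewrite (horner_coef_wide (n := m)); last exact: leq_trans (size_poly _ _) _.
  apply: eq_bigr => i _; rewrite coef_map ffunE; congr (_%:~R * _).
  by have := qB i; move: (q`_i) => x xB; rewrite inordK; lia.
have [rho /andP[rho_gt1 rho_le] rhoP] :=
  @finite_gap R (T * T)%type (fun t => val_T t.2 / val_T t.1) beta beta_gt1.
exists rho => // q q' Dq Dq' q_ge lt_qq'.
have [big|lt_q'] := leP (beta * `|ev q|) `|ev q'|.
  by apply: le_trans big; rewrite ler_wpM2r.
have q_gt0 : 0 < `|ev q| := lt_le_trans ltr01 q_ge.
have [n /andP[n_le n_gt]] : exists n, beta ^+ n <= `|ev q| < beta ^+ n.+1.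
  have ex_n : exists n, `|ev q| < beta ^+ n.
    have [k le_k] := expr_unbounded (`|ev q| + 1) beta_gt1.
    by exists k; apply: lt_le_trans le_k; rewrite ltrDl.
  case: (ex_minnP ex_n) => -[|n] q_lt min_n; first by move: q_lt; rewrite expr0 ltNge q_ge.
  by exists n; rewrite q_lt andbT leNgt; apply/negP => /min_n; rewrite ltnn.
have bn_gt0 : 0 < beta ^+ n by apply: exprn_gt0.
have scale (r : {poly int}) : divides_const N r -> exists r1 : {poly int}, [/\ (size r1 <= m)%N,
    divides_const N r1 & `|ev r1| = `|ev r| / beta ^+ n].
  move=> [h rh]; have [r1 sz_r1 r1E] := reduce_mod_P (r * poly_beta_inv ^+ n).
  have {}r1E : ev r1 = ev r / beta ^+ n.
    by rewrite r1E evM rmorphXn /= horner_exp ev_beta_inv exprVn.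
  exists r1; split=> //; last by rewrite r1E normrM normfV (gtr0_norm bn_gt0).
  exists (h * 'X^n); rewrite evM r1E rmorphXn /= map_polyX hornerXn.
  by rewrite mulrACA mulVf ?gt_eqF // mulr1.
have [r [sz_r Dr rE]] := scale q Dq; have [r' [sz_r' Dr' rE']] := scale q' Dq'.
have [|t tE] := @T_small r.
  split=> //; rewrite rE ler_pdivlMr // mul1r n_le ltr_pdivrMr //=.
  by apply: lt_trans n_gt _; rewrite -exprD ltr_eXn2l // add2n.
have [|t' tE'] := @T_small r'.
  split=> //; rewrite rE' ler_pdivlMr // mul1r (le_trans n_le (ltW lt_qq')).
  rewrite ltr_pdivrMr //=; apply: lt_trans lt_q' _.
  by rewrite expr2 -mulrA ltr_pM2l // -exprS.
have ratioE : val_T t' / val_T t = `|ev q'| / `|ev q|.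
  rewrite -tE -tE' rE rE' invf_div mulrA -(mulrA `|_|) mulVf ?gt_eqF // mulr1.
  by [].
have := rhoP (t, t'); rewrite /= ratioE ltr_pdivlMr // mul1r ler_pdivlMr //.
by apply.
Qed.

End RankOne.

(** * The norm form of a vector of consecutive terms *)

Section Krylov.
Variables (R : realType) (beta : R) (P : {poly int}).
Hypotheses (mon_P : P \is monic).
Hypothesis dvd_P : forall q : {poly int}, root (zpoly q) beta -> exists r, q = P * r.
Hypothesis root_P : root (zpoly P) beta.

Local Notation ev q := ((zpoly q).[beta]).
Local Notation d := (size P).-1.
Local Notation M := (companionmx P).

Lemma deg_gt0 : (0 < d)%N.
Proof.
have := @root_size_gt1 _ beta (zpoly P).
have -> : size (zpoly P : {poly R}) = size P.
  by rewrite size_map_inj_poly //; apply: intr_inj.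
rewrite -size_poly_eq0 size_map_inj_poly // ?size_poly_eq0; last exact: intr_inj.
by rewrite monic_neq0 // => /(_ isT root_P); case: (size P) => [|[]].
Qed.

Let size_PS : size P = d.+1.
Proof. by have := deg_gt0; case: (size P). Qed.

Let ord_last : 'I_d. Proof. by exists d.-1; rewrite prednK // deg_gt0. Defined.
Let ord_first : 'I_d := Ordinal deg_gt0.

Lemma companionmxE i j :
  M i j = (i.+1 == j)%:R - (i == ord_last)%:R * P`_j.
Proof.
rewrite mxE -val_eqE /=; case: eqP => [->|_]; last by rewrite mul0r subr0.
rewrite mul1r prednK ?deg_gt0 //.
by rewrite gtn_eqF ?ltn_ord // sub0r.
Qed.

Lemma sqr_det_companion : P`_0 * P`_0 = 1 -> \det M ^+ 2 = 1.
Proof.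
move=> P0.
have := char_poly_det M; rewrite companionmxK // => P0E.
by move: P0; rewrite P0E mulrACA -!expr2 sqrr_sign mul1r.
Qed.

(** The Horner remainders of [P] at [beta]: the entries of the left eigenvector
of the companion matrix for the eigenvalue [beta]. *)
Let l k : R := ev (drop_poly k P).

Lemma l_rec k : l k = beta * l k.+1 + (P`_k)%:~R.
Proof.
rewrite /l; have -> : drop_poly k P = 'X * drop_poly k.+1 P + (P`_k)%:P.
  apply/polyP => i; rewrite coefD coefC coef_drop_poly coefXM coef_drop_poly.
  by case: i => [|i] /=; rewrite ?add0r // addr0 addSnnS.
by rewrite rmorphD rmorphM /= map_polyX map_polyC /= !hornerE.
Qed.

Lemma l0 : l 0 = 0.
Proof. by rewrite /l drop_poly0l; apply/rootP. Qed.

Lemma ld : l d = 1.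
Proof.
rewrite /l; have -> : drop_poly d P = 1; last by rewrite rmorph1 hornerC.
apply/polyP => i; rewrite coef_drop_poly coef1; case: i => [|i] /=.
  by rewrite -lead_coefE (monicP mon_P).
by rewrite nth_default // size_PS addSn ltnS leq_addl.
Qed.

Let L : 'rV[R]_d := \row_j l j.+1.

Lemma L_eigen : L *m map_mx intr M = beta *: L.
Proof.
apply/rowP => j; rewrite [LHS]mxE [RHS]mxE [L _ _]mxE.
under eq_bigr => i _ do
  rewrite [L _ _]mxE [map_mx _ _ _ _]mxE companionmxE rmorphB rmorphM /= !rmorph_nat mulrBr.
rewrite sumrB; have -> : \sum_(i < d) l i.+1 * (i.+1 == j)%:R = l j.
  case: j => -[|j] lt_jd /=; first by rewrite l0 big1 // => i _; rewrite mulr0.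
  rewrite (bigD1 (Ordinal (ltnW lt_jd))) //= eqxx mulr1 big1 ?addr0 // => i.
  by rewrite -val_eqE /= eqSS => /negPf ->; rewrite mulr0.
rewrite (bigD1 ord_last) //= eqxx mul1r big1 ?addr0 => [|i /negPf ->]; last first.
  by rewrite mul0r mulr0.
by rewrite prednK ?deg_gt0 // ld mul1r l_rec addrK.
Qed.

(** A polynomial whose value at [beta] is the pairing of [v] with the left
eigenvector, so that it represents [xi v] in [Z[beta]]. *)
Definition xi_poly (v : 'cV[int]_d) : {poly int} :=
  \sum_(j < d) v j 0 *: drop_poly j.+1 P.

Lemma ev_xi v : ev (xi_poly v) = (L *m map_mx intr v) 0 0.
Proof.
rewrite rmorph_sum /= horner_sum mxE; apply: eq_bigr => j _.
by rewrite map_polyZ hornerZ mulrC !mxE.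
Qed.

Lemma xiD v w : ev (xi_poly (v + w)) = ev (xi_poly v) + ev (xi_poly w).
Proof. by rewrite !ev_xi map_mxD mulmxDr mxE. Qed.

Lemma xiN v : ev (xi_poly (- v)) = - ev (xi_poly v).
Proof. by rewrite !ev_xi map_mxN mulmxN mxE. Qed.

Lemma xi_companion v : ev (xi_poly (M *m v)) = beta * ev (xi_poly v).
Proof. by rewrite !ev_xi map_mxM mulmxA L_eigen -scalemxAl mxE. Qed.

Definition krylov_mx (v : 'cV[int]_d) : 'M[int]_d :=
  \matrix_(i, k) iter k (mulmx M) v i 0.

Lemma krylov_mxM v : krylov_mx (M *m v) = M *m krylov_mx v.
Proof.
apply/matrixP => i k; rewrite !mxE -iterSr iterS mxE.
by apply: eq_bigr => j _; rewrite [krylov_mx _ _ _]mxE.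
Qed.

Lemma sqr_det_krylov v : P`_0 * P`_0 = 1 ->
  \det (krylov_mx (M *m v)) ^+ 2 = \det (krylov_mx v) ^+ 2.
Proof.
by move=> /sqr_det_companion detM; rewrite krylov_mxM det_mulmx exprMn detM mul1r.
Qed.

(** Column [k] of the Krylov matrix is [M^k v], and [xi (M^k v)] is
[beta^k * xi v]. *)
Lemma L_krylov v :
  L *m map_mx intr (krylov_mx v) = \row_k (beta ^+ k * ev (xi_poly v)).
Proof.
apply/rowP => k; rewrite [RHS]mxE.
have -> : beta ^+ k * ev (xi_poly v) = ev (xi_poly (iter k (mulmx M) v)).
  elim: (k : nat) => [|j IHj]; first by rewrite expr0 mul1r.
  by rewrite iterS xi_companion -IHj exprS mulrA.
by rewrite ev_xi !mxE; apply: eq_bigr => i _; rewrite !mxE.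
Qed.

(** Multiply [L_krylov] by the adjugate on the right and read the last entry,
where the eigenvector [L] has a 1. *)
Lemma xi_divides_det v :
  exists h : {poly int}, ev (xi_poly v) * ev h = (\det (krylov_mx v))%:~R.
Proof.
pose K := krylov_mx v.
exists (\sum_(k < d) (\adj K k ord_last) *: 'X^k).
have /rowP/(_ ord_last) : L *m map_mx intr K *m map_mx intr (\adj K) = (\det K)%:~R *: L.
  by rewrite -mulmxA -map_mxM mul_mx_adj map_scalar_mx mul_mx_scalar.
rewrite L_krylov [RHS]mxE [L _ _]mxE /= prednK ?deg_gt0 // ld mulr1 => <-.
move: (ev (xi_poly v)) => x; rewrite rmorph_sum /= horner_sum mulr_sumr mxE; apply: eq_bigr => k _.
rewrite map_polyZ hornerZ map_polyXn hornerXn !mxE; ring.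
Qed.

(** A rational vector [c] in the kernel of the Krylov matrix gives
[xi v * \sum_k c_k beta^k = 0], while [1, beta, .., beta^(d-1)] are independent
over the rationals. *)
Lemma det_krylov_neq0 v : ev (xi_poly v) != 0 -> \det (krylov_mx v) != 0.
Proof.
move=> nz_xi; apply/negP => /eqP det0.
pose K : 'M[rat]_d := map_mx intr (krylov_mx v).
have /eqP/det0P[c nz_c cK] : \det K^T = 0 by rewrite det_tr det_map_mx det0.
have root_c : root (map_poly ratr (rVpoly c)) beta.
  have : (L *m map_mx ratr (K *m c^T)) 0 0 = 0.
    have -> : K *m c^T = (c *m K^T)^T by rewrite trmx_mul trmxK.
    by rewrite cK trmx0 map_mx0 mulmx0 mxE.
  rewrite map_mxM mulmxA.
  have -> : map_mx ratr K = map_mx intr (krylov_mx v) :> 'M[R]_d.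
    by apply/matrixP => i j; rewrite !mxE ratr_int.
  rewrite L_krylov mxE.
  under eq_bigr => k _ do rewrite mxE mulrAC.
  rewrite -mulr_suml => /eqP; rewrite mulf_eq0 (negPf nz_xi) orbF => /eqP c0.
  apply/rootP; rewrite -[RHS]c0 (horner_coef_wide (n := d)); last first.
    by rewrite (leq_trans (size_poly _ _)) // size_poly.
  by apply: eq_bigr => k _; rewrite coef_map coef_rVpoly_ord !mxE mulrC.
have [q [a nz_a cE]] := rat_poly_scale (rVpoly c).
have : root (zpoly q) beta.
  move: root_c; rewrite cE map_polyZ map_ratr_zpoly rootZ //.
  by rewrite fmorph_eq0 invr_eq0 intr_eq0.
case/dvd_P => r qE.
have nz_q : q != 0.
  apply: contra_neq nz_c => q0; apply: (can_inj rVpolyK).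
  by rewrite cE q0 map_poly0 scaler0 linear0.
have : (size q <= d)%N.
  rewrite -size_rat_int_poly -(@size_scale _ a%:~R^-1) -?cE ?size_poly //.
  by rewrite invr_eq0 intr_eq0.
have nz_r : r != 0 by apply: contraNneq nz_q => r0; rewrite qE r0 mulr0.
have := size_PS; rewrite -size_poly_gt0 in nz_r.
by rewrite qE size_monicM -?size_poly_gt0 //; move: nz_r deg_gt0; lia.
Qed.

(** As a polynomial of degree less than [d] vanishing at [beta], [xi_poly v] is
zero, and its coefficient of degree [d - 1] is the first entry of [v]. *)
Lemma xi_eq0_first v : ev (xi_poly v) = 0 -> v ord_first 0 = 0.
Proof.
move=> /eqP/dvd_P[r xiE].
have sz_xi : (size (xi_poly v) <= d)%N.
  apply: (leq_trans (size_sum _ _ _)); apply/bigmax_leqP => j _.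
  apply: leq_trans (size_scale_leq _ _) _.
  by rewrite size_drop_poly; move: (nat_of_ord j) => k; lia.
have r0 : r = 0.
  apply: contraTeq sz_xi => nz_r; rewrite xiE size_monicM //.
  by rewrite -size_poly_gt0 in nz_r; move: nz_r deg_gt0; lia.
have := congr1 (fun q : {poly int} => q`_d.-1) xiE.
rewrite r0 mulr0 coef0 coef_sum (bigD1 ord_first) //= coefZ coef_drop_poly.
rewrite addn1 prednK ?deg_gt0 // -lead_coefE (monicP mon_P) mulr1 big1 ?addr0 //.
move=> j nz_j; rewrite coefZ coef_drop_poly nth_default ?mulr0 //.
have : (j : nat) != 0%N := nz_j.
have := deg_gt0; rewrite addnS; case: (nat_of_ord j) => // k + _.
by rewrite addnS; case: (size P) => [|[|s]] //= _; rewrite !ltnS leq_addr.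
Qed.

(** The shift by [2^-1] turns the floor into the nearest integer: it recovers
consecutive terms [n_(i+j)] from [n_i] alone once they are close to
[beta^j n_i]. *)
Definition round_powers (x : int) : 'cV[int]_d :=
  \col_j Num.floor (beta ^+ j * x%:~R + 2^-1).

Lemma round_powers_first x : round_powers x ord_first 0 = x.
Proof. by rewrite mxE expr0 mul1r; apply/floor_def; rewrite intrD mulr1z; lra. Qed.

Lemma gp_det_krylov :
  generalised_polynomial (fun x => (\det (krylov_mx (round_powers x)))%:~R : R).
Proof.
apply: gp_det => i k; apply: gp_ext (_ : generalised_polynomial
  (fun x => (iter k (mulmx M) (round_powers x) i 0)%:~R)) => [x|].
  by rewrite mxE.
elim: (k : nat) i => [|j IHj] i /=.
  apply: gp_ext (GPfloor (GPadd (GPmul (GPconst (beta ^+ i)) (@GPid R)) (GPconst 2^-1))) => x.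
  by rewrite mxE.
by apply: (@gp_mulmx _ _ _ _ M) => a b; rewrite (ord1 b); apply: IHj.
Qed.

Lemma xi_round_powers : exists c B : R, forall x,
  `|ev (xi_poly (round_powers x)) - c * x%:~R| <= B.
Proof.
exists (\sum_(j < d) l j.+1 * beta ^+ j), (\sum_(j < d) `|l j.+1|) => x.
rewrite ev_xi mxE mulr_suml -sumrB; apply: le_trans (ler_norm_sum _ _ _) _.
apply: ler_sum => j _; rewrite !mxE -mulrA -mulrBr normrM ler_piMr //.
have /andP[] := floor_itv (beta ^+ j * x%:~R + 2^-1).
by rewrite intrD mulr1z ler_norml => *; apply/andP; split; lra.
Qed.

(** If [b beta = c] with [b] nonzero, then [P] has degree 1, so
[beta = - P`_0] has square 1. *)
Lemma irrational_beta : 1 < beta -> P`_0 * P`_0 = 1 -> irrational beta.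
Proof.
move=> beta_gt1 P0 /rationalP[c [b bE]]; have nz_b : b != 0%N.
  by apply: contra_ltN beta_gt1 => /eqP b0; rewrite bE b0 invr0 mulr0 ler01.
have [|r qE] := @dvd_P (b%:Z *: 'X - c%:P).
  apply/rootP; rewrite rmorphB /= map_polyZ map_polyX map_polyC /= !hornerE.
  by rewrite -pmulrn bE mulrCA mulfV ?mulr1 ?subrr // pnatr_eq0.
have b1 : b%:Z = (b%:Z *: 'X - c%:P)`_1 by rewrite coefB coefZ coefX coefC mulr1 subr0.
have nz_r : r != 0.
  by apply: contra_neq nz_b => r0; apply/eqP; rewrite -eqz_nat b1 qE r0 mulr0 coef0.
have sz2 : size P = 2.
  have : (size (b%:Z *: 'X - c%:P)%R <= 2)%N.
    apply: leq_trans (size_polyD _ _) _; rewrite geq_max size_polyN.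
    rewrite (leq_trans (size_scale_leq _ _)) ?size_polyX //=.
    by rewrite (leq_trans (size_polyC_leq1 _)).
  rewrite qE size_monicM //; have := deg_gt0; rewrite -size_poly_gt0 in nz_r.
  by move: nz_r; case: (size r) => // s _; case: (size P) => [|[|k]] //=; lia.
have PE : P = 'X + (P`_0)%:P.
  apply/polyP => -[|[|i]]; rewrite coefD coefX coefC ?add0r //=.
    by have := monicP mon_P; rewrite lead_coefE sz2 addr0.
  by rewrite nth_default ?sz2.
have : beta * beta = 1.
  have := rootP root_P; rewrite PE rmorphD /= map_polyX map_polyC /= !hornerE.
  move=> /eqP; rewrite addr_eq0 => /eqP ->; rewrite mulrNN.
  by rewrite -rmorphM P0.
by nra.
Qed.

End Krylov.

Lemma expr_small (R : realType) (r K e : R) : 0 <= r -> r < 1 -> 0 <= K -> 0 < e ->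
  exists i0, forall i, (i0 <= i)%N -> K * r ^+ i < e.
Proof.
move=> r0 r1 K0 e0.
suff [i0 i0P] : exists i0, K * r ^+ i0 < e.
  exists i0 => i le_i; apply: le_lt_trans i0P.
  by rewrite ler_wpM2l // ler_wiXn2l // ltW.
move: r0; rewrite le_eqVlt => /predU1P[<-|r0]; first by exists 1%N; rewrite expr1 mulr0.
have [|k kP] := @expr_unbounded R r^-1 (K / e + 1); first by rewrite invf_gt1.
exists k; rewrite exprVn in kP; have rk : 0 < r ^+ k by rewrite exprn_gt0.
have : K / e < (r ^+ k)^-1 by apply: lt_le_trans kP; rewrite ltrDl.
by rewrite ltr_pdivrMr // ltr_pdivlMl // mulrC.
Qed.

Lemma iterated_decay (R : realType) (b r K : R) (w : nat -> R) D :
  0 <= b -> 0 <= r -> r < 1 -> 0 <= K ->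
  (forall i, `|w i.+1 - b * w i| <= K * r ^+ i) ->
  exists2 L : R, 0 <= L &
    forall i j, (j <= D)%N -> `|w (i + j)%N - b ^+ j * w i| <= L * r ^+ i.
Proof.
move=> b0 r0 r1 K0 wK; elim: D => [|D [L L0 LP]].
  exists 0 => // i j; rewrite leqn0 => /eqP ->.
  by rewrite addn0 expr0 mul1r subrr normr0 mul0r.
exists (L + (K + b * L)) => [|i j]; first by rewrite !addr_ge0 // mulr_ge0.
have ri : 0 <= r ^+ i by rewrite exprn_ge0.
rewrite leq_eqVlt ltnS => /predU1P[->|/(LP i) le_L]; last first.
  by apply: le_trans le_L _; rewrite ler_wpM2r // lerDl addr_ge0 // mulr_ge0.
have -> : w (i + D.+1)%N - b ^+ D.+1 * w i =
    (w (i + D).+1 - b * w (i + D)%N) + b * (w (i + D)%N - b ^+ D * w i).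
  by rewrite addnS exprS; ring.
apply: le_trans (ler_normD _ _) _; rewrite normrM (ger0_norm b0).
rewrite [leRHS]mulrDl; apply: le_trans (_ : (K + b * L) * r ^+ i <= _); last first.
  by rewrite lerDr mulr_ge0.
rewrite mulrDl -mulrA; apply: lerD; last by rewrite ler_wpM2l // LP.
apply: le_trans (wK _) _; rewrite ler_wpM2l // ler_wiXn2l ?leq_addr //.
exact: ltW.
Qed.

(** * The values of the recurrence *)

Section Recurrence.
Variables (R : realType) (beta : R) (P : {poly int}) (rs : seq R[i]) (n : nat -> int).
Hypotheses (beta_gt1 : 1 < beta) (mon_P : P \is monic).
Hypothesis dvd_P : forall q : {poly int}, root (zpoly q) beta -> exists r, q = P * r.
Hypothesis root_P : root (zpoly P) beta.
Hypothesis P0 : P`_0 * P`_0 = 1.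
Hypotheses (uniq_rs : uniq rs) (P_rs : zpoly P = \prod_(z <- rs) ('X - z%:P)).
Hypothesis rank1 : mul_rank (unit_group (ring_of_integers (Q_adjoin beta))) 1.
Hypothesis int_beta : algebraic_integer beta.
Hypothesis conj_lt1 : forall z, z \in rs -> z != (beta%:C)%C -> `|z| < 1.

Local Notation d := (size P).-1.
Local Notation M := (companionmx P).
Local Notation ev q := ((zpoly q).[beta]).

Hypothesis n_rec : forall i, n (i + d)%N = \sum_(j < d) - P`_j * n (i + j)%N.

Let nvec i : 'cV[int]_d := \col_j n (i + j)%N.

Let beta_gt0 : 0 < beta := lt_trans ltr01 beta_gt1.

Lemma nvecS i : nvec i.+1 = M *m nvec i.
Proof.
have d_gt0 := deg_gt0 mon_P root_P.
apply/colP => k; rewrite !mxE; have [k_last|k_nlast] := eqVneq (k : nat) d.-1.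
  have -> : (i.+1 + k = i + d)%N by rewrite k_last addSn -addnS prednK.
  by rewrite n_rec; apply: eq_bigr => j _; rewrite !mxE k_last eqxx.
have lt_kd : (k.+1 < d)%N.
  by rewrite ltn_neqAle ltn_ord andbT -[X in _ != X]prednK // eqSS.
rewrite (bigD1 (Ordinal lt_kd)) //= big1 => [|j].
  by rewrite !mxE (negPf k_nlast) eqxx mul1r addr0 /= addSnnS.
rewrite -val_eqE /= eq_sym => /negPf j_neq.
by rewrite !mxE (negPf k_nlast) j_neq mul0r.
Qed.

Lemma beta_in_rs : (beta%:C)%C \in rs.
Proof.
rewrite -root_prod_XsubC -P_rs.
have -> : zpoly P = map_poly (real_complex R) (zpoly P) :> {poly R[i]}.
  by rewrite -map_poly_comp; apply: eq_map_poly => z /=; rewrite rmorph_int.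
by rewrite fmorph_root.
Qed.

(** The sequence [n_(i+1) - beta n_i] is killed by [P / ('X - beta)], all of
whose roots lie in the open unit disc. *)
Lemma n_decay : exists r K : R, [/\ 0 <= r, r < 1, 0 <= K &
  forall i, `|(n i.+1)%:~R - beta * (n i)%:~R| <= K * r ^+ i].
Proof.
apply: (@geometric_decay_real _ (rem (beta%:C)%C rs)
    (fun i => (n i.+1)%:~R - beta * (n i)%:~R)) => [a|i].
  by rewrite mem_rem_uniq // => /andP[ab rs_a]; apply: conj_lt1.
have P_split : zpoly P = \prod_(a <- rem (beta%:C)%C rs) ('X - a%:P) * ('X - ((beta%:C)%C)%:P).
  by rewrite P_rs (big_rem _ beta_in_rs) mulrC.
have <- : poly_shift (zpoly P) (fun j => (n j)%:~R : R[i]) i = 0.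
  rewrite (@poly_shift_wide _ d.+1); last first.
    by rewrite (leq_trans (size_poly _ _)) // leqSpred.
  rewrite big_ord_recr /= [X in _ + X](_ : _ = (n (i + d)%N)%:~R); last first.
    by rewrite coef_map /= -lead_coefE (monicP mon_P) mul1r.
  rewrite n_rec rmorph_sum -big_split big1 // => j _.
  by rewrite coef_map /= rmorphM rmorphN mulNr addrN.
rewrite P_split poly_shift_mulXsubC; congr (poly_shift _ _ i).
by apply/funext => j; rewrite rmorphB rmorphM /= !rmorph_int.
Qed.

Lemma round_powers_n : exists i0, forall i, (i0 <= i)%N ->
  round_powers beta P (n i) = nvec i.
Proof.
have [r [K [r0 r1 K0 nK]]] := n_decay.
have [L L0 LP] := iterated_decay d (ltW beta_gt0) r0 r1 K0 nK.
have [|i0 i0P] := @expr_small R r L 2^-1 r0 r1 L0; first by rewrite invr_gt0.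
exists i0 => i /i0P lt_half; apply/colP => j; rewrite !mxE; apply/floor_def.
have := le_lt_trans (LP i j (ltnW (ltn_ord j))) lt_half.
by rewrite intrD mulr1z ltr_norml => /andP[]; move=> *; apply/andP; split; lra.
Qed.

Let xi i := ev (xi_poly (nvec i)).

Lemma xiE i : xi i = beta ^+ i * xi 0%N.
Proof.
elim: i => [|i IHi]; first by rewrite expr0 mul1r.
by rewrite /xi nvecS xi_companion // -/(xi i) IHi exprS mulrA.
Qed.

Lemma xi0_eq0 : xi 0%N = 0 -> forall i, n i = 0.
Proof.
move=> xi0 i; have /(xi_eq0_first mon_P dvd_P root_P) : xi i = 0.
  by rewrite xiE xi0 mulr0.
by rewrite mxE /= addn0.
Qed.

Lemma recurrence_values_gp (I : set nat) :
  generalised_polynomial_set R [set n i | i in I].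
Proof.
have irr := irrational_beta mon_P dvd_P root_P beta_gt1 P0.
have [xi0|nz_xi0] := eqVneq (xi 0%N) 0.
  apply: (@gpset_seq R beta [:: 0]) => // _ [i _ <-].
  by rewrite xi0_eq0 // inE.
pose N : int := \det (krylov_mx (nvec 0)).
have nz_N : N != 0 by apply: (det_krylov_neq0 mon_P dvd_P root_P).
have [rho rho_gt1 rhoP] :=
  value_gap beta_gt1 mon_P dvd_P root_P P0 uniq_rs P_rs rank1 int_beta nz_N.
have [i0 i0P] := round_powers_n.
have [c [B cB]] := xi_round_powers beta P.
pose v x := round_powers beta P x.
pose E0 : set int := [set x | \det (krylov_mx (v x)) ^+ 2 - N ^+ 2 = 0].
have gpE0 : generalised_polynomial_set R E0.
  apply: gpset_zero irr _.
  have gpD := gp_exp 2 (gp_det_krylov beta P).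
  apply: gp_ext (gp_sub gpD (GPconst (N%:~R ^+ 2))) => x.
  by rewrite rmorphB !rmorphXn.
have E0_div x : E0 x -> divides_const beta N (xi_poly (v x)).
  move=> /eqP; rewrite subr_sqr mulf_eq0 => Ex.
  have [h hE] := xi_divides_det mon_P root_P (v x).
  case/orP: Ex; rewrite ?subr_eq0 ?addr_eq0 => /eqP Ex.
    by exists h; rewrite hE Ex.
  exists (- h); rewrite rmorphN hornerN mulrN hE.
  by rewrite Ex rmorphN opprK.
have E0_n i : (i0 <= i)%N -> E0 (n i).
  move=> /i0P vE; rewrite /E0 /= /v vE {vE}; apply/eqP; rewrite subr_eq0; apply/eqP.
  elim: i => [//|i IHi]; by rewrite nvecS sqr_det_krylov.
have B0 : 0 <= B := le_trans (normr_ge0 _) (cB 0).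
have xi_big T : exists i1, forall i, (i1 <= i)%N -> T <= `|xi i|.
  have [k kP] := expr_unbounded (T / `|xi 0%N|) beta_gt1.
  exists k => i le_ki; rewrite xiE normrM -ler_pdivrMr ?normr_gt0 //.
  rewrite [`|beta ^+ i|]ger0_norm ?exprn_ge0 ?(ltW beta_gt0) //.
  by apply: le_trans kP _; rewrite ler_weXn2l // ltW.
have xi_c i : (i0 <= i)%N -> `|xi i - c * (n i)%:~R| <= B.
  by move=> /i0P vE; have := cB (n i); rewrite vE.
(* Otherwise [xi i] would be bounded, whereas it grows like [beta^i]. *)
have nz_c : c != 0.
  have [i1 i1P] := xi_big (B + 1).
  apply: contraTneq (i1P (maxn i0 i1) (leq_maxr _ _)) => c0.
  have := xi_c (maxn i0 i1) (leq_maxl _ _).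
  by rewrite c0 mul0r subr0 -ltNge => le_B; apply: le_lt_trans le_B _; rewrite ltrDl.
have c_gt0 : 0 < `|c| by rewrite normr_gt0.
have E0_xi x : `|c| * `|x|%:~R - B <= `|ev (xi_poly (v x))| <= `|c| * `|x|%:~R + B.
  have := cB x; rewrite -/(v x); set y := ev _ => yB.
  have -> : `|c| * `|x|%:~R = `|c * x%:~R| by rewrite normrM intr_norm.
  have := ler_normB y (y - c * x%:~R); have := ler_normD (y - c * x%:~R) (c * x%:~R).
  by rewrite subrK opprB addrCA subrr addr0 => *; apply/andP; split; lra.
have xi_first u w : ev (xi_poly u) = ev (xi_poly w) ->
    u (Ordinal (deg_gt0 mon_P root_P)) 0 = w (Ordinal (deg_gt0 mon_P root_P)) 0.
  move=> uw; have : ev (xi_poly (u - w)) = 0 by rewrite xiD xiN uw subrr.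
  by move=> /(xi_eq0_first mon_P dvd_P root_P); rewrite !mxE => /subr0_eq.
(* The first entry of [v x] is [x], so [xi (v x)] determines [x]. *)
have xi_inj x y : `|ev (xi_poly (v x))| = `|ev (xi_poly (v y))| -> `|x| = `|y|.
  have v_first z := round_powers_first mon_P root_P z.
  move=> /eqP; rewrite eqr_norm2 => /orP[] /eqP.
    by move=> /xi_first; rewrite !v_first => ->.
  by rewrite -xiN => /xi_first; rewrite [RHS]mxE !v_first => ->; rewrite normrN.
(* Above the threshold [T], the error [B] in [xi (v x) = c x + O(B)] costs at
   most half of the excess [rho - 1] of the ratio. *)
pose T := (B + 1) * (1 + (1 + rho) * 2 / (rho - 1)).
have rho1_gt0 : 0 < rho - 1 by rewrite subr_gt0.
have T_gt : B + 1 <= T.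
  have quot_ge0 : 0 <= (1 + rho) * 2 / (rho - 1).
    by rewrite divr_ge0 ?(ltW rho1_gt0) // mulr_ge0 //; lra.
  by rewrite /T mulrDr mulr1 lerDl mulr_ge0 // addr_ge0.
have T_gt0 : 0 < T by apply: lt_le_trans T_gt; rewrite ltr_wpDl.
have T_rho : (1 + rho) * B <= (rho - 1) / 2 * T.
  have -> : (rho - 1) / 2 * T = (B + 1) * ((rho - 1) / 2 + (1 + rho)).
    by rewrite /T; field; rewrite gt_eqF // subr_gt0.
  have BT : 0 <= B * (rho - 1) by rewrite mulr_ge0 // subr_ge0 ltW.
  by lra.
move: T T_gt T_gt0 T_rho => T T_gt T_gt0 T_rho.
have [X X_gt] : exists X : nat, T / `|c| < X%:R.
  exists (Num.bound (T / `|c|)); apply/archi_boundP.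
  by rewrite divr_ge0 // ltW.
have X_T (x : int) : X%:Z <= `|x| -> T <= `|c| * `|x|%:~R.
  rewrite mulrC -ler_pdivrMr // -(ler_int R) => le_X; apply: le_trans le_X.
  exact: ltW.
pose E : set int := E0 `&` ~` [set x | `|x| < X%:Z].
have E_big x : E x -> E0 x /\ T <= `|c| * `|x|%:~R.
  by case=> E0x /= /negP; rewrite -leNgt => /X_T.
have gpE : generalised_polynomial_set R E.
  apply: gpset_setI => //; apply: gpset_setC.
  by apply: (gpset_bounded (X := X) irr) => x; rewrite /= -abszE ltz_nat.
have [i1 i1P] := xi_big (2 * B + `|c| * (X%:R + 1)).
pose i2 := maxn i0 i1.
have i2_i0 i : (i2 <= i)%N -> (i0 <= i)%N by apply: leq_trans; apply: leq_maxl.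
have i2_i1 i : (i2 <= i)%N -> (i1 <= i)%N by apply: leq_trans; apply: leq_maxr.
pose A : set int := [set n i | i in [set i | I i /\ (i2 <= i)%N]].
have gap x y : E x -> E y -> `|ev (xi_poly (v x))| < `|ev (xi_poly (v y))| ->
    (1 + rho) / 2 * (`|c| * `|x|%:~R) <= `|c| * `|y|%:~R.
  move=> /E_big[E0x x_big] /E_big[E0y y_big] lt_xi.
  have := rhoP _ _ (E0_div _ E0x) (E0_div _ E0y).
  have := E0_xi x; have := E0_xi y; move: lt_xi x_big y_big.
  move: `|ev (xi_poly (v x))| `|ev (xi_poly (v y))|.
  move: (`|c| * `|x|%:~R) (`|c| * `|y|%:~R) => X' Y a b lt_ab X'_big _.
  move=> /andP[_ b_le] /andP[a_ge _] /(_ _ lt_ab) ab.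
  have {ab}ab : rho * a <= b by apply: ab; lra.
  have le1 : (rho - 1) / 2 * T <= (rho - 1) / 2 * X'.
    by apply: ler_wpM2l; lra.
  have le2 : rho * (X' - B) <= rho * a by apply: ler_wpM2l; lra.
  by lra.
have gpA : generalised_polynomial_set R A.
  apply: (@gpset_subset_lacunary R ((1 + rho) / 2) E A) => //.
  - by lra.
  - move=> x /E_big[_ x_big]; apply: contraTneq x_big => ->.
    by rewrite normr0 mulr0 -ltNge.
  - move=> x y Ex Ey lt_xy.
    have lt_cxy : `|c| * `|x|%:~R < `|c| * `|y|%:~R by rewrite ltr_pM2l // ltr_int.
    rewrite -(ler_pM2l c_gt0) mulrCA.
    case: (ltgtP `|ev (xi_poly (v x))| `|ev (xi_poly (v y))|) => [/gap|/gap|/xi_inj].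
    + exact.
    + move=> /(_ Ey Ex).
      have [_ y_big] := E_big _ Ey.
      by nra.
    + by move=> xy; rewrite xy ltxx in lt_xy.
  - move=> _ [i [_ le_i] <-]; split; first by apply/E0_n/i2_i0.
    move=> /= lt_nX; have := xi_c i (i2_i0 _ le_i).
    have := i1P i (i2_i1 _ le_i).
    have : `|c * (n i)%:~R| <= `|c| * X%:R.
      rewrite normrM ler_wpM2l // -intr_norm pmulrn ler_int ltW //.
    have := ler_normD (xi i - c * (n i)%:~R) (c * (n i)%:~R).
    by rewrite subrK mulrDr mulr1; lra.
  (* If [n i = - n j] then [xi i + xi j = O(2 B)], although [xi i] and [xi j]
     are large and have the same sign, that of [xi 0]. *)
  move=> _ [i [_ le_i] <-] [j [_ le_j] nji].
  have le_xi : `|xi i| <= `|xi i + xi j|.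
    rewrite (xiE i) (xiE j) -mulrDl !normrM ler_wpM2r //.
    rewrite !ger0_norm ?addr_ge0 ?exprn_ge0 ?(ltW beta_gt0) //.
    by rewrite lerDl exprn_ge0 // ltW.
  have := xi_c i (i2_i0 _ le_i); have := xi_c j (i2_i0 _ le_j).
  have := i1P i (i2_i1 _ le_i); rewrite nji rmorphN /= mulrN opprK.
  move: (xi i) (xi j) (c * _) le_xi => u w y le_uw u_big w_B u_B.
  have := ler_normD (u - y) (w + y); rewrite addrACA addNr addr0.
  have : 0 < `|c| * (X%:R + 1) by rewrite mulr_gt0 // ltr_wpDl.
  by lra.
suff -> : [set n i | i in I] =
    A `|` [set n i | i in [set i | I i /\ (i < i2)%N]].
  apply: gpset_setU => //; apply: (@gpset_seq R beta [seq n i | i <- iota 0 i2]) => //.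
  move=> _ [i [_ lt_i] <-]; apply: map_f; by rewrite mem_iota.
apply/seteqP; split=> [_ [i Ii <-]|_ [[i [Ii _] <-]|[i [Ii _] <-]]].
  2-3: by exists i.
by have [le_i|lt_i] := leqP i2 i; [left | right]; exists i.
Qed.

End Recurrence.

Theorem theoremC (R : realType) (beta : R) (p : {poly rat}) (n : nat -> int)
    (I : set nat) :
  Pisot_unit beta ->
  mul_rank (unit_group (ring_of_integers (Q_adjoin beta))) 1 ->
  minimal_polynomial beta p ->
  linear_recurrent p (fun i => (n i)%:~R) ->
  generalised_polynomial_set R [set n i | i in I].
Proof.
move=> [beta_gt1 int_beta int_betaV conj_lt1] rank1 min_p [_ n_rec].
have [P mon_P pE] := minimal_polynomial_int min_p int_beta.
have nz_beta : beta != 0 by rewrite gt_eqF // (lt_trans ltr01).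
have root_P : root (zpoly P) beta.
  by have [_ + _] := min_p; rewrite pE map_ratr_zpoly.
have [rs] := closed_field_poly_normal (zpoly P : {poly R[i]}).
have -> : lead_coef (zpoly P : {poly R[i]}) = 1.
  by rewrite lead_coef_map_inj ?(monicP mon_P) //; apply: intr_inj.
rewrite scale1r => P_rs.
apply: (@recurrence_values_gp R beta P rs n) => //.
- by move=> q; apply: minimal_polynomial_dvdz min_p _ _ mon_P pE.
- exact: minimal_polynomial_const min_p _ mon_P pE nz_beta int_betaV.
- rewrite -(separable_prod_XsubC rs) -P_rs -map_ratr_zpoly separable_map -pE.
  exact: minimal_polynomial_separable min_p.
- move=> z rs_z; apply: conj_lt1; exists p => //.
  by rewrite pE map_ratr_zpoly P_rs root_prod_XsubC.
move=> i; apply: (@intr_inj rat); have := n_rec i.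
rewrite pE size_rat_int_poly => ->; rewrite rmorph_sum; apply: eq_bigr => j _.
by rewrite coef_map rmorphM rmorphN.
Qed.
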